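(* Let $G=(V,E)$ be a connected graph with vertex colouring $\omega$ from colour-set $C$. Then $m(u,v)$ can be computed for every pair of vertices $u,v\in V$ in total time $O(|V|^3|E||C|^2)$.
   Context: Free-Flood-It: for a graph $G$ with vertex colouring $\omega$ from colour-set $C$, a move $(v,d)$ gives colour $d$ to every vertex of the monochromatic connected component containing $v$ in the current colouring; moves may be played at any vertex. $m(u,v,d)$ is the minimum number of moves needed so that $u$ and $v$ lie in a common monochromatic connected component of colour $d$, and $m(u,v)=\min_{d\in C} m(u,v,d)$ is the minimum number of moves needed to link $u$ and $v$ (put them in a common monochromatic component). *)

(* Defs.v *)
From mathcomp Require Import all_boot.

Set Implicit Arguments.
Unset Strict Implicit.
Unset Printing Implicit Defensive.

Section Graphs.
Variables (V : finType) (e : rel V).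

Definition simple_graph : Prop := symmetric e /\ irreflexive e.

Definition connected_graph : Prop := forall x y : V, connect e x y.

Definition edges : {set {set V}} := [set [set x; y] | x in V, y in V & e x y].

(* es lists every edge exactly once, in any order, with either orientation. *)
Definition edge_listing (es : seq (V * V)) : Prop :=
  perm_eq [seq [set p.1; p.2] | p <- es] (enum edges).

End Graphs.

Section FreeFloodIt.
Variables (V C : finType) (e : rel V).

Definition colouring := {ffun V -> C}.

Definition mono_component (w : colouring) (v : V) : {set V} :=
  [set x | connect [rel y z | e y z && (w y == w z)] v x].

Definition flood (w : colouring) (mv : V * C) : colouring :=
  [ffun x => if x \in mono_component w mv.1 then mv.2 else w x].

Definition play (w : colouring) (s : seq (V * C)) : colouring :=
  foldl flood w s.

Definition linked_in (w : colouring) (u v : V) (d : C) : bool :=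
  (v \in mono_component w u) && (w u == d).

Definition linkable (w : colouring) (u v : V) (d : C) : pred nat :=
  fun t => [exists s : t.-tuple (V * C), linked_in (play w s) u v d].

Lemma play_const (w : colouring) (d : C) (s : seq V) (x : V) :
  x \in s \/ w x = d -> play w [seq (v, d) | v <- s] x = d.
Proof.
elim: s w => [|v s IHs] w /=; first by case.
rewrite inE => xs; apply: IHs; rewrite ffunE /=.
case: ifP => [_|xNv]; first by right.
case: xs => [/orP[/eqP xv|xs]|wx]; [|by left|by right].
by rewrite xv inE connect0 in xNv.
Qed.

Lemma linkable_ex (e_conn : connected_graph e) (w : colouring) u v d :
  exists t, linkable w u v d t.
Proof.
exists #|V|; apply/existsP.
have sz : size [seq (x, d) | x <- enum V] == #|V| by rewrite size_map -cardE.
exists (Tuple sz).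
have wd x : play w [seq (x, d) | x <- enum V] x = d.
  by apply: play_const; left; rewrite mem_enum.
rewrite /linked_in /= wd eqxx andbT inE.
rewrite (@eq_connect _ _ e) // => x y /=.
by rewrite !wd eqxx andbT.
Qed.

Definition m3 (e_conn : connected_graph e) (w : colouring) (u v : V) (d : C)
  : nat := ex_minn (linkable_ex e_conn w u v d).

(* The minimum over all d : C; the default value m3 u v (w u) of the iterated
   minimum is one of the values over which the minimum is taken. *)
Definition m2 (e_conn : connected_graph e) (w : colouring) (u v : V) : nat :=
  \big[minn/m3 e_conn w u v (w u)]_(d : C) m3 e_conn w u v d.

End FreeFloodIt.

(* Random access machine with the uniform cost measure: a finite program acts
   on registers and on a memory, both indexed by nat and containing naturals.
   There is no multiplication, and subtraction is truncated. *)

Inductive instr : Type :=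
| IConst of nat & nat      (* IConst r c : R[r] <- c *)
| IAdd of nat & nat & nat  (* IAdd r s t : R[r] <- R[s] + R[t] *)
| ISub of nat & nat & nat  (* ISub r s t : R[r] <- R[s] - R[t] *)
| ILoad of nat & nat       (* ILoad r s  : R[r] <- M[R[s]] *)
| IStore of nat & nat      (* IStore r s : M[R[r]] <- R[s] *)
| IJz of nat & nat.        (* IJz r l    : if R[r] = 0 goto l *)

Definition program := seq instr.

Record config := Config { pc : nat; regs : nat -> nat; memory : nat -> nat }.

Definition upd (f : nat -> nat) (i x : nat) : nat -> nat :=
  fun j => if j == i then x else f j.

Definition exec (i : instr) (c : config) : config :=
  let: Config p R M := c in
  match i with
  | IConst r k => Config p.+1 (upd R r k) M
  | IAdd r s t => Config p.+1 (upd R r (R s + R t)) M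
  | ISub r s t => Config p.+1 (upd R r (R s - R t)) M
  | ILoad r s => Config p.+1 (upd R r (M (R s))) M
  | IStore r s => Config p.+1 R (upd M (R r) (R s))
  | IJz r l => Config (if R r == 0 then l else p.+1) R M
  end.

(* A configuration whose program counter is outside the program is halted. *)
Definition halted (P : program) (c : config) : bool := size P <= pc c.

Definition step (P : program) (c : config) : config :=
  if onth P (pc c) is Some i then exec i c else c.

Definition init (input : seq nat) : config :=
  Config 0 (fun _ => 0) (nth 0 input).

(* Since halted configurations are fixed by step, this says that P halts after
   at most t steps, with the output in the memory cells 0, 1, 2, ... *)
Definition computes_within (P : program) (input output : seq nat) (t : nat)
  : Prop :=
  let c := iter t (step P) (init input) in
  halted P c /\ forall i, i < size output -> memory c i = nth 0 output i.

(* Vertices and colours are represented by their ranks in enum V and enum C. *)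
Definition encode_instance (V C : finType) (es : seq (V * V))
    (w : colouring V C) : seq nat :=
  [:: #|V|; size es; #|C|]
  ++ [seq nat_of_ord (enum_rank (w v)) | v <- enum V]
  ++ flatten [seq [:: nat_of_ord (enum_rank p.1); nat_of_ord (enum_rank p.2)]
             | p <- es].

(* The |V| x |V| table of f, in row-major order. *)
Definition encode_table (V : finType) (f : V -> V -> nat) : seq nat :=
  [seq f u v | u <- enum V, v <- enum V].

(* Main.v *)
Require Import Defs.
From mathcomp Require Import all_boot all_order.
From mathcomp Require Import zify.

(** The cost of a colour word is the least number of recolourings in a
derivation that turns the word into a constant word: a letter is free, a derived
word may be recoloured at cost 1, and two words derived to the same colour may
be concatenated. Then m(u,v,d) is the least cost, over all walks from u to v, of
deriving the colour word of the walk to d. The cost does not increase when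
letters are deleted, so walks may be shortcut through monochromatic components.
If the first move of an optimal play floods the component K, a walk for the
resulting colouring can be shortcut so as to visit K in a single block, and
undoing the move then costs one recolouring. Conversely, on a walk visiting each
component at most once, an innermost recolouring of the derivation acts on one
component, and flooding that component decreases the cost by one.

Derivations satisfy m(u,v,d) = min(1 + m(u,v,d'), m(u,x,d) + m(y,v,d)) over
colours d' and edges xy. A walk can be taken to be a path and m(u,v,d) is at
most |V|, which bounds the depth of its derivation by 2|V|; hence 2|V| rounds of
relaxing every entry (u,v,d) compute the whole table. The recolourings of a row
(u,v) need only its minimum, so a round takes time O(|V|^2 |E| |C|). *)

Set Implicit Arguments.
Unset Strict Implicit.
Unset Printing Implicit Defensive.

(** * Sequences and paths *)

Lemma cat_eq_cat_cons (T : Type) (s t s1 s2 : seq T) c :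
    s ++ t = s1 ++ c :: s2 ->
  (exists2 r, s = s1 ++ c :: r & s2 = r ++ t) \/
  (exists2 r, s1 = s ++ r & t = r ++ c :: s2).
Proof.
elim: s s1 => [|x s IH] [|y s1] /=.
- by move=> ->; right; exists [::].
- by move=> ->; right; exists (y :: s1).
- by case=> <- <-; left; exists s.
case=> -> /IH[[r -> ->]|[r -> ->]]; first by left; exists r.
by right; exists r.
Qed.

Lemma map_eq_cat_cons (T U : Type) (f : T -> U) s r1 b r2 :
    map f s = r1 ++ b :: r2 ->
  exists s1 x s2,
    [/\ s = s1 ++ x :: s2, map f s1 = r1, f x = b & map f s2 = r2].
Proof.
elim: r1 s => [|a r1 IH] [|x s] //= [fx].
  by exists [::], x, s.
case/IH=> s1 [y [s2 [-> <- <- <-]]].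
by exists (x :: s1), y, s2; rewrite -fx.
Qed.

Lemma subseq_cat_split (T : eqType) (r s t : seq T) : subseq r (s ++ t) ->
  exists r1 r2, [/\ r = r1 ++ r2, subseq r1 s & subseq r2 t].
Proof.
case/subseqP=> m; rewrite size_cat => sz_m ->.
exists (mask (take (size s) m) s), (mask (drop (size s) m) t).
rewrite !mask_subseq -mask_cat ?cat_take_drop //.
by rewrite size_takel // sz_m leq_addr.
Qed.

Lemma split_first_last (T : Type) (P : pred T) s : has P s ->
  exists s1 a m s2, [/\ s = s1 ++ (a :: m) ++ s2, P a, P (last a m),
                        ~~ has P s1 & ~~ has P s2].
Proof.
elim: s => //= x s IH; case: (boolP (has P s)) => [/IH|nPs].
  case=> s1 [a [m [s2 [-> Pa Pl n1 n2]]]] _; case Px: (P x).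
    by exists [::], x, (s1 ++ a :: m), s2; rewrite -catA last_cat.
  by exists (x :: s1), a, m, s2; rewrite /= Px.
by rewrite orbF => Px; exists [::], x, [::], s.
Qed.

Lemma path_uniq_subseq (T : eqType) (e : rel T) x p : path e x p ->
  exists q, [/\ path e x q, uniq (x :: q), last x q = last x p & subseq q p].
Proof.
elim: p x => [|y p IH] x /=; first by exists [::].
case/andP=> exy /IH[q [e_q uniq_q <- sub_q]].
have sub_yq : subseq (y :: q) (y :: p) by rewrite /= eqxx.
have [x_in|x_notin] := boolP (x \in y :: q); last first.
  by exists (y :: q); split; rewrite //= ?exy // x_notin.
have [q1 [q2 Eq]] : exists q1 q2, y :: q = q1 ++ x :: q2.
  by case/splitPr: x_in => q1 q2; exists q1, q2.
have : path e x (y :: q) by rewrite /= exy.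
rewrite Eq cat_path /= => /and3P[_ _ e_q2]; exists q2; split=> //.
- by move: uniq_q; rewrite Eq cat_uniq => /and3P[].
- by rewrite -(last_cons x y) Eq last_cat.
apply: subseq_trans sub_yq; rewrite Eq.
exact: subseq_trans (subseq_cons _ _) (suffix_subseq _ _).
Qed.

Lemma path_reroute (T : Type) (e : rel T) u p s1 a m m' s2 : path e u p ->
    u :: p = s1 ++ (a :: m) ++ s2 -> path e a m' -> last a m' = last a m ->
  exists q,
    [/\ u :: q = s1 ++ (a :: m') ++ s2, path e u q & last u q = last u p].
Proof.
move=> e_p + e_m' Em; case: s1 => [|x s1] [Eu Ep]; move: e_p; rewrite Eu Ep.
  rewrite cat_path last_cat => /andP[_ e_s2]; exists (m' ++ s2).
  by rewrite cat_path !last_cat Em e_m'.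
rewrite cat_path last_cat /= cat_path last_cat => /and4P[e_s1 ea _ e_s2].
exists (s1 ++ (a :: m') ++ s2).
by rewrite cat_path last_cat /= cat_path last_cat Em e_s1 ea e_m'.
Qed.

Lemma nth_allpairs (S T U : Type) (g : S -> T -> U) s t x y z i j :
    i < size s -> j < size t ->
  nth z [seq g a b | a <- s, b <- t] (i * size t + j)
    = g (nth x s i) (nth y t j).
Proof.
elim: s i => // a s IH [|i] lt_i lt_j; rewrite allpairs_cons nth_cat size_map.
  by rewrite lt_j (nth_map y).
rewrite mulSn -addnA ltnNge leq_addr /= addKn; exact: IH.
Qed.

Lemma nth_flatten_pairs (S T : Type) (g h : S -> T) s x y i : i < size s ->
  let l := flatten [seq [:: g p; h p] | p <- s] in
  nth y l i.*2 = g (nth x s i) /\ nth y l i.*2.+1 = h (nth x s i).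
Proof. by elim: s i => // p s IH [|i] //= /IH. Qed.

(** * Derivations of colour words *)

Inductive derives (C : Type) : seq C -> C -> nat -> Prop :=
| derives_letter c : derives [:: c] c 0
| derives_recolour s (a d : C) k : derives s a k -> derives s d k.+1
| derives_cat s t d k l :
    derives s d k -> derives t d l -> derives (s ++ t) d (k + l).

Section Words.
Variable C : eqType.
Implicit Types (s t : seq C) (c d : C).

Lemma derives_nonempty s d k : derives s d k -> s != [::].
Proof. by elim=> // -[|x s1] t {}d {}k l. Qed.

Lemma derives_leq s d k l : k <= l -> derives s d k -> derives s d l.
Proof.
move=> /subnK <-; elim: (l - k) => // m IH D.
exact/derives_recolour/IH.
Qed.

Lemma derives_constant s d : s != [::] -> all (pred1 d) s -> derives s d 0.
Proof.
elim: s => //= x [|y s] IH _ /andP[/eqP -> sd]; first exact: derives_letter.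
exact: derives_cat (derives_letter d) (IH isT sd).
Qed.

Lemma derives0_constant s d : derives s d 0 -> all (pred1 d) s.
Proof.
move Ek: 0 => k D; elim: D Ek => //= [c|s1 t {}d {}k l _ IHs _ IHt].
  by rewrite eqxx.
move/esym/eqP; rewrite addn_eq0 all_cat => /andP[/eqP k0 /eqP l0].
by rewrite IHs ?IHt.
Qed.

Lemma derives_size s d : s != [::] -> derives s d (size s).
Proof.
elim: s => //= x [|y s] IH _; first exact/derives_recolour/derives_letter.
exact: derives_cat (derives_recolour d (derives_letter x)) (IH isT).
Qed.

Lemma derives_subst s1 c s2 d k t l :
    derives (s1 ++ c :: s2) d k -> derives t c l ->
  derives (s1 ++ t ++ s2) d (k + l).
Proof.
move Es: (s1 ++ c :: s2) => s D Dt.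
elim: D s1 s2 Es => {s d k} [b|s a d k _ IH|r s d k m Dr IHr Ds IHs] s1 s2 Es.
- by case: s1 Es => [|? [|? ?]] //= [<- ->]; rewrite cats0.
- by rewrite addSn; apply/derives_recolour/IH.
case: (cat_eq_cat_cons (esym Es)) => [[q Er ->]|[q -> Eq]].
  rewrite addnAC !catA -(catA s1).
  exact: derives_cat (IHr _ _ (esym Er)) Ds.
by rewrite -addnA -catA; apply: derives_cat => //; apply: IHs.
Qed.

Lemma derives_subseq s d k r : derives s d k -> subseq r s -> r != [::] ->
  derives r d k.
Proof.
move=> D; elim: D r => {s d k} [c|s a d k _ IH|s t d k l _ IHs _ IHt] r.
- case: r => // y [|z r] sub_r _; last by have := size_subseq sub_r.
  by move: sub_r; rewrite sub1seq inE => /eqP ->; apply: derives_letter.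
- by move=> sub_r r_neq0; apply/derives_recolour/IH.
case/subseq_cat_split=> [[|x r1] [[|y r2] [-> sub_r1 sub_r2]]] // _.
- by apply: derives_leq (IHt _ sub_r2 isT); apply: leq_addl.
- by rewrite cats0; apply: derives_leq (IHs _ sub_r1 isT); apply: leq_addr.
exact: derives_cat (IHs _ sub_r1 isT) (IHt _ sub_r2 isT).
Qed.

(* In a word without equal neighbours, an innermost recolouring acts on a
   single letter, so it can be performed first. *)
Lemma derives_letter_first s d k : derives s d k ->
  sorted [rel a b | a != b] s -> 0 < k ->
  exists s1 a s2 c, s = s1 ++ a :: s2 /\ derives (s1 ++ c :: s2) d k.-1.
Proof.
elim=> {s d k} // [s a d [|k] D IH|s t d k l Ds IHs Dt IHt] sorted_s.
- move=> _; have := derives0_constant D.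
  case: s D sorted_s {IH} => [/derives_nonempty //|x [|y s]] /= _.
    by exists [::], x, [::], d; split=> //; apply: derives_letter.
  by case/andP=> /= xy _ /and3P[/eqP Ex /eqP Ey _]; rewrite Ex Ey eqxx in xy.
- case: (IH sorted_s isT) => s1 [b [s2 [c [-> D']]]] _.
  by exists s1, b, s2, c; split=> //; apply: derives_recolour D'.
have [ss st] := cat_sorted2 sorted_s; case: k Ds IHs => [|k] Ds IHs l_gt0.
  case: (IHt st l_gt0) => s1 [b [s2 [c [Et D]]]].
  exists (s ++ s1), b, s2, c; rewrite Et -!catA; split=> //.
  exact: (derives_cat Ds D).
case: (IHs ss isT) => s1 [b [s2 [c [Es D]]]].
exists s1, b, (s2 ++ t), c; rewrite Es -catA; split=> //.
by have := derives_cat D Dt; rewrite -catA.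
Qed.

End Words.

(** * Walks that derive to a colour *)

Section Walks.
Variables (V C : finType) (e : rel V).
Implicit Types (w : colouring V C) (u v : V) (d : C).

Definition walk_derives w u v d k : Prop :=
  exists p, [/\ path e u p, last u p = v & derives (map w (u :: p)) d k].

Lemma walk_derives_leq w u v d k l :
  k <= l -> walk_derives w u v d k -> walk_derives w u v d l.
Proof.
by move=> le_kl [p [e_p lp D]]; exists p; split=> //; apply: derives_leq D.
Qed.

Lemma walk_derives_refl w u : walk_derives w u u (w u) 0.
Proof. by exists [::]; split=> //; apply: derives_letter. Qed.

Lemma walk_derives_recolour w u v a d k :
  walk_derives w u v a k -> walk_derives w u v d k.+1.
Proof.
by case=> p [e_p lp D]; exists p; split=> //; apply: derives_recolour D.
Qed.

Lemma walk_derives_cat w u x y v d k l : walk_derives w u x d k -> e x y ->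
  walk_derives w y v d l -> walk_derives w u v d (k + l).
Proof.
move=> [p [e_p lp Dp]] exy [q [e_q lq Dq]]; exists (p ++ y :: q).
rewrite last_cat cat_path lp /= e_p exy; split=> //.
by have := derives_cat Dp Dq; rewrite -map_cat.
Qed.

Lemma walk_derives_path w u v d k : walk_derives w u v d k ->
  exists p, [/\ path e u p, last u p = v, uniq (u :: p) &
                derives (map w (u :: p)) d k].
Proof.
case=> p [/path_uniq_subseq[q [e_q uniq_q <- sub_q]] lp D].
exists q; split=> //; apply: derives_subseq D _ _ => //.
by apply: map_subseq; rewrite /= eqxx.
Qed.

Lemma walk_derives_card w u v d : connect e u v -> walk_derives w u v d #|V|.
Proof.
case/connectP=> p /path_uniq_subseq[q [e_q uniq_q <- _]] ->.
exists q; split=> //.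
apply: (@derives_leq _ _ _ (size (map w (u :: q)))); last exact: derives_size.
by rewrite size_map -(card_uniqP uniq_q) max_card.
Qed.

End Walks.

(** * Flooding *)

Local Notation mono e w := [rel y z | e y z && (w y == w z)].

Section Flooding.
Variables (V C : finType) (e : rel V).
Hypothesis e_sym : symmetric e.
Implicit Types (w : colouring V C) (u v x y : V) (c d : C).

Local Notation component w := (root (mono e w)).

Lemma mono_connect_sym w : connect_sym (mono e w).
Proof. by apply: sym_connect_sym => x y; rewrite /= e_sym eq_sym. Qed.

Lemma mono_path_colour w x p : path (mono e w) x p ->
  path e x p /\ all (pred1 (w x)) (map w p).
Proof.
elim: p x => //= y p IH x /andP[/andP[exy /eqP wxy] /IH[e_p wp]].
by rewrite exy e_p wxy eqxx.
Qed.

Lemma connect_mono_colour w x y : connect (mono e w) x y -> w y = w x.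
Proof.
case/connectP=> p /mono_path_colour[_ /allP wp] ->; apply/eqP.
case/lastP: p wp => //= p z wp; rewrite last_rcons.
by apply: wp; rewrite map_rcons mem_rcons mem_head.
Qed.

Lemma floodE w y c x :
  flood e w (y, c) x = if connect (mono e w) y x then c else w x.
Proof. by rewrite ffunE inE. Qed.

Lemma map_flood_away w y c s : ~~ has (connect (mono e w) y) s ->
  map (flood e w (y, c)) s = map w s.
Proof.
move/hasPn=> away; apply/eq_in_map => x /away /negPf ny.
by rewrite floodE ny.
Qed.

Lemma connect_flood w mv :
  subrel (connect (mono e w)) (connect (mono e (flood e w mv))).
Proof.
case: mv => y c; apply: connect_sub => a b ab; apply: connect1.
have /andP[/= eab wab] := ab; rewrite /= eab !floodE (eqP wab).
by rewrite (same_connect_r (mono_connect_sym w) (connect1 ab)) eqxx.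
Qed.

(* If the walk meets the flooded component, replace the part between its first
   and its last visit by a walk inside the component: undoing the flooding then
   amounts to expanding the single remaining letter at the cost of one
   recolouring. *)
Lemma walk_derives_flood w mv u v d k :
  walk_derives e (flood e w mv) u v d k -> walk_derives e w u v d k.+1.
Proof.
case: mv => y c [p [e_p lp D]].
have [|away] := boolP (has (connect (mono e w) y) (u :: p)); last first.
  apply: walk_derives_leq (leqnSn k) _; exists p; split=> //.
  by rewrite -(map_flood_away c away).
case/split_first_last=> s1 [a [m [s2 [Es ya yb away1 away2]]]].
have : connect (mono e w) a (last a m).
  by rewrite -(same_connect (mono_connect_sym w) ya).
case/connectP=> m' /mono_path_colour[e_m' wm'] /esym Em.
have [q [Eq e_q lq]] := path_reroute e_p Es e_m' Em.
exists q; rewrite e_q lq; split=> //; rewrite Eq !map_cat -addn1.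
apply: (@derives_subst _ _ c).
  apply: derives_subseq D _ _; last by case: (map w s1).
  rewrite Es !map_cat !(map_flood_away c away1, map_flood_away c away2) /=.
  by rewrite floodE ya cat_subseq //= eqxx suffix_subseq.
by apply/(@derives_recolour _ _ (w a))/derives_constant; rewrite //= eqxx.
Qed.

Lemma linkable_walk_derives w u v d t :
  linkable e w u v d t -> walk_derives e w u v d t.
Proof.
elim: t w => [|t IH] w /existsP[s].
  rewrite tuple0 /linked_in inE /= => /andP[/connectP[p mono_p ->] /eqP wu].
  have [e_p wp] := mono_path_colour mono_p; exists p; split=> //.
  by apply: derives_constant; rewrite //= -wu eqxx.
case/tupleP: s => mv s s_links; apply: (walk_derives_flood (mv := mv)).
by apply: IH; apply/existsP; exists s.
Qed.

(* A path of this relation is a chain of monochromatic components, each given by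
   one of its vertices. *)
Definition adjacent w : rel V := fun x y =>
  [exists x', exists y',
    [&& connect (mono e w) x x', e x' y' & connect (mono e w) y' y]].

Lemma adjacentP w x y : reflect
  (exists x' y',
     [/\ connect (mono e w) x x', e x' y' & connect (mono e w) y' y])
  (adjacent w x y).
Proof.
apply: (iffP existsP) => [[x' /existsP[y' /and3P[xx' exy yy']]]|].
  by exists x', y'.
case=> x' [y' [xx' exy yy']]; exists x'; apply/existsP; exists y'.
by rewrite xx' exy yy'.
Qed.

Lemma edge_adjacent w : subrel e (adjacent w).
Proof. by move=> x y exy; apply/adjacentP; exists x, y. Qed.

Lemma adjacent_flood w mv : subrel (adjacent w) (adjacent (flood e w mv)).
Proof.
move=> x y /adjacentP[x' [y' [xx' exy yy']]].
by apply/adjacentP; exists x', y'; split=> //; apply: connect_flood.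
Qed.

Lemma adjacent_component w : {homo component w : x y / adjacent w x y}.
Proof.
move=> x y /adjacentP[x' [y' [xx' exy yy']]]; apply/adjacentP; exists x', y'.
split=> //; last exact: connect_trans yy' (connect_root _ _).
by apply: connect_trans xx'; rewrite mono_connect_sym connect_root.
Qed.

Lemma adjacent_same_colour w x y :
  adjacent w x y -> w x = w y -> connect (mono e w) x y.
Proof.
case/adjacentP=> x' [y' [xx' exy yy']] wxy; apply: (connect_trans xx').
apply: (connect_trans (connect1 _) yy').
by rewrite /= exy (connect_mono_colour xx') wxy (connect_mono_colour yy') eqxx.
Qed.

Lemma chain_same_colour w x p d : path (adjacent w) x p ->
  all (pred1 d) (map w (x :: p)) -> connect (mono e w) x (last x p).
Proof.
elim: p x => //= y p IH x /andP[xy adj_p] /and3P[/eqP wx /eqP wy wp].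
apply: connect_trans (adjacent_same_colour xy _) (IH y adj_p _).
  by rewrite wx wy.
by rewrite /= wy eqxx.
Qed.

Lemma chain_distinct_components w x p : path (adjacent w) x p ->
  exists x' p',
    [/\ path (adjacent w) x' p', uniq (map (component w) (x' :: p')),
        connect (mono e w) x x', connect (mono e w) (last x' p') (last x p) &
        subseq (map w (x' :: p')) (map w (x :: p))].
Proof.
set r := component w => adj_p; have csym := mono_connect_sym w.
have [q [adj_q uniq_q lq sub_q]] :=
  path_uniq_subseq (homo_path (@adjacent_component w) adj_p).
have r_root z : r (r z) = r z by apply: root_root.
exists (r x), q; rewrite lq last_map; split=> //.
- rewrite map_id_in // => z.
  by case/predU1P=> [->|/(mem_subseq sub_q)/mapP[z' _ ->]].
- exact: connect_root.
- by rewrite csym connect_root.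
have -> : map w (x :: p) = map w (map r (x :: p)).
  rewrite -map_comp; apply: eq_map => z /=.
  by rewrite (connect_mono_colour (connect_root _ z)).
by apply: map_subseq; rewrite /= eqxx.
Qed.

Lemma chain_distinct_colours w x p :
    path (adjacent w) x p -> uniq (map (component w) (x :: p)) ->
  sorted [rel a b | a != b] (map w (x :: p)).
Proof.
move=> adj_p; rewrite uniq_pairwise => /pairwise_sorted.
rewrite !sorted_map /= => neq_p.
have : path [rel y z | adjacent w y z && (component w y != component w z)] x p.
  by rewrite path_relI adj_p.
apply: sub_path => y z /= /andP[yz]; apply: contraNneq => wyz.
exact/eqP/(rootP (mono_connect_sym w))/adjacent_same_colour.
Qed.

Lemma map_flood_distinct_components w s1 y c s2 :
    uniq (map (component w) (s1 ++ y :: s2)) ->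
  map (flood e w (y, c)) (s1 ++ y :: s2) = map w s1 ++ c :: map w s2.
Proof.
have csym := mono_connect_sym w.
rewrite map_cat /= uniq_catC cons_uniq mem_cat negb_or => /andP[/andP[y2 y1] _].
have away s : component w y \notin map (component w) s ->
    ~~ has (connect (mono e w) y) s.
  by apply: contra => /hasP[z zs /(rootP csym) ->]; apply: map_f.
by rewrite map_cat /= floodE connect0 !map_flood_away ?away.
Qed.

End Flooding.

(** * The minimum number of moves *)

Section LinkingNumbers.
Variables (V C : finType) (e : rel V).
Hypothesis e_sym : symmetric e.
Hypothesis e_conn : connected_graph e.
Implicit Types (w : colouring V C) (u v x y : V) (c d : C).

Local Notation m3 := (m3 e_conn).
Local Notation m2 := (m2 e_conn).

Lemma linkable_m3 w u v d : linkable e w u v d (m3 w u v d).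
Proof. by rewrite /m3; case: ex_minnP. Qed.

Lemma m3_le_linkable w u v d t : linkable e w u v d t -> m3 w u v d <= t.
Proof. by rewrite /m3; case: ex_minnP => m _; apply. Qed.

Lemma m3_flood w mv u v d : m3 w u v d <= (m3 (flood e w mv) u v d).+1.
Proof.
have /existsP[s s_links] := linkable_m3 (flood e w mv) u v d.
by apply: m3_le_linkable; apply/existsP; exists [tuple of mv :: s].
Qed.

Lemma m3_le_chain w u v d k x p : path (adjacent e w) x p ->
    connect (mono e w) u x -> connect (mono e w) (last x p) v ->
    derives (map w (x :: p)) d k ->
  m3 w u v d <= k.
Proof.
elim: k w x p => [|k IH] w x p adj_p ux pv D.
  have all_d := derives0_constant D; have xp := chain_same_colour adj_p all_d.
  apply/m3_le_linkable/existsP; exists [tuple]; rewrite /linked_in inE /=.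
  rewrite (connect_trans ux (connect_trans xp pv)) -(connect_mono_colour ux).
  by case/andP: all_d.
have [x' [p' [adj_p' uniq_p' xx' pp' sub_p']]] :=
  chain_distinct_components e_sym adj_p.
have {}D : derives (map w (x' :: p')) d k.+1.
  exact: derives_subseq D sub_p' _.
have colours_p' := chain_distinct_colours e_sym adj_p' uniq_p'.
have [s1 [a [s2 [c [Es Dc]]]]] := derives_letter_first D colours_p' isT.
have [q1 [y [q2 [Eq E1 _ E2]]]] := map_eq_cat_cons Es.
apply: leq_trans (m3_flood w (y, c) u v d) _; rewrite ltnS.
have into_flood := @connect_flood _ _ _ e_sym w (y, c).
apply: (IH _ x' p').
- exact: sub_path (@adjacent_flood _ _ _ e_sym w (y, c)) _ _ adj_p'.
- exact/into_flood/(connect_trans ux xx').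
- exact/into_flood/(connect_trans pp' pv).
rewrite Eq in uniq_p' *.
by rewrite map_flood_distinct_components // E1 E2.
Qed.

Lemma m3_leP w u v d k : walk_derives e w u v d k <-> m3 w u v d <= k.
Proof.
split=> [[p [e_p <- D]]|le_k]; last first.
  apply: walk_derives_leq le_k (linkable_walk_derives e_sym _).
  exact: linkable_m3.
apply: m3_le_chain (connect0 _ u) (connect0 _ _) D.
exact: sub_path (@edge_adjacent _ _ _ w) _ _ e_p.
Qed.

Lemma m3_refl w u : m3 w u u (w u) = 0.
Proof. by apply/eqP; rewrite -leqn0; apply/m3_leP/walk_derives_refl. Qed.

Lemma m3_recolour w u v a d : m3 w u v d <= (m3 w u v a).+1.
Proof. by apply/m3_leP/(@walk_derives_recolour _ _ _ _ _ _ a)/m3_leP. Qed.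

Lemma m3_edge w u x y v d : e x y -> m3 w u v d <= m3 w u x d + m3 w y v d.
Proof.
by move=> exy; apply/m3_leP; apply: walk_derives_cat exy _; apply/m3_leP.
Qed.

Lemma m3_le_card w u v d : m3 w u v d <= #|V|.
Proof. by apply/m3_leP/walk_derives_card/e_conn. Qed.

Lemma m2_eq_min w u v k : (forall d, k <= m3 w u v d) ->
  (exists d, m3 w u v d = k) -> m2 w u v = k.
Proof.
move=> k_le [d Ek]; apply/anti_leq/andP; split.
  by rewrite -Ek; apply: (Order.TotalTheory.bigmin_le (T := nat)).
by rewrite /m2; elim/big_ind: _ => // a b; rewrite leq_min => -> ->.
Qed.

Lemma m2_refl w u : m2 w u u = 0.
Proof. by apply: m2_eq_min => //; exists (w u); apply: m3_refl. Qed.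

(** * Relaxing a table of upper bounds *)

Definition relaxes (g h : V -> V -> C -> nat) : Prop :=
  [/\ forall u v d, h u v d <= g u v d,
      forall u v a d, h u v d <= (g u v a).+1 &
      forall u x y v d, e x y -> h u v d <= g u x d + g y v d].

(* A derivation with [k] recolourings of a word of length [l + 1] has depth at
   most [k + l]. *)
Definition reaches w (r : nat) (g : V -> V -> C -> nat) : Prop :=
  forall u p d k, path e u p -> derives (map w (u :: p)) d k ->
    k + size p <= r -> g u (last u p) d <= k.

Lemma reaches0 w g : (forall u, g u u (w u) = 0) -> reaches w 0 g.
Proof.
move=> g_refl u p d k _ D.
rewrite leqn0 addn_eq0 => /andP[/eqP k0 /eqP/size0nil p0].
move: D; rewrite k0 p0 => /derives0_constant /=; rewrite andbT => /eqP <-.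
by rewrite g_refl.
Qed.

Lemma reachesS w r g h : relaxes g h -> reaches w r g -> reaches w r.+1 h.
Proof.
case=> h_le h_recolour h_edge g_reaches u p d k e_p.
move Es: (map w (u :: p)) => s D.
case: D Es => {s d k} [c|s a d k D|s t d k l Ds Dt] Es.
- case: p Es e_p => // -[wu] _ _; apply: leq_trans (h_le _ _ _) _.
  by apply: (g_reaches _ [::]) => //=; rewrite wu; apply: derives_letter.
- rewrite addSn ltnS => le_r; apply: leq_trans (h_recolour _ _ a _) _.
  by rewrite ltnS g_reaches ?Es.
move: (derives_nonempty Ds) (derives_nonempty Dt).
case: s t Ds Dt Es => [|c s] [|c' t] //= Ds Dt [wu Ep] _ _.
have [p1 [y [p2 [Eq E1 wy E2]]]] := map_eq_cat_cons Ep.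
move: e_p; rewrite {}Eq cat_path last_cat size_cat /=.
move=> /and3P[e_p1 ey e_p2] le_r.
apply: leq_trans (h_edge _ _ _ _ _ ey) (leq_add _ _); apply: g_reaches => //.
- by rewrite /= wu E1.
- by lia.
- by rewrite /= wy E2.
by lia.
Qed.

Lemma reaches_m3 w g u v d : reaches w (#|V| + #|V|) g -> g u v d <= m3 w u v d.
Proof.
have : walk_derives e w u v d (m3 w u v d) by apply/m3_leP.
case/walk_derives_path=> p [e_p <- uniq_p D].
move/(_ u p d _ e_p D); apply; apply: leq_add (m3_le_card _ _ _ _) _.
by apply: ltnW; rewrite -[_.+1]/(size (u :: p)) -(card_uniqP uniq_p) max_card.
Qed.

End LinkingNumbers.

(** * Structured programs for the random access machine *)

Definition state : Type := ((nat -> nat) * (nat -> nat))%type.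

Inductive cmd : Type :=
| Do of seq instr
| Seq of cmd & cmd
| Loop of nat & cmd.

Infix ";;" := Seq (at level 61, right associativity).

Arguments upd _ _ _ _ /.

Definition exec_state (s : state) (i : instr) : state :=
  let c := exec i (Config 0 s.1 s.2) in (regs c, memory c).

(* Register 0 is scratch space: it turns [IJz] into an unconditional jump. *)
Definition decrement (r : nat) : seq instr :=
  [:: IConst 0 1; ISub r r 0; IConst 0 0].

Definition tick (r : nat) (s : state) : state :=
  foldl exec_state s (decrement r).

Fixpoint run (c : cmd) (s : state) : state :=
  match c with
  | Do l => foldl exec_state s l
  | Seq a b => run b (run a s)
  | Loop r a => iter (s.1 r) (fun t => tick r (run a t)) s
  end.

Fixpoint cost (c : cmd) (s : state) : nat :=
  match c with
  | Do l => size l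
  | Seq a b => cost a s + cost b (run a s)
  | Loop r a =>
      (\sum_(i < s.1 r) (cost a (iter i (fun t => tick r (run a t)) s) + 5)).+1
  end.

Fixpoint code_size (c : cmd) : nat :=
  match c with
  | Do l => size l
  | Seq a b => code_size a + code_size b
  | Loop r a => code_size a + 5
  end.

Fixpoint compile (p : nat) (c : cmd) : program :=
  match c with
  | Do l => l
  | Seq a b => compile p a ++ compile (p + code_size a) b
  | Loop r a =>
      IJz r (p + code_size a + 5)
        :: compile p.+1 a ++ decrement r ++ [:: IJz 0 p]
  end.

Definition target (i : instr) : seq nat :=
  match i with
  | IConst r _ | IAdd r _ _ | ISub r _ _ | ILoad r _ => [:: r]
  | IStore _ _ | IJz _ _ => [::]
  end.

Fixpoint writes (c : cmd) : seq nat :=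
  match c with
  | Do l => flatten (map target l)
  | Seq a b => writes a ++ writes b
  | Loop r a => 0 :: r :: writes a
  end.

Definition is_jump (i : instr) : bool := if i is IJz _ _ then true else false.

(* The body of a loop may not write to the loop counter, so that the number of
   passes is the value of the counter on entry, as in [run]. *)
Fixpoint well_formed (c : cmd) : bool :=
  match c with
  | Do l => ~~ has is_jump l
  | Seq a b => well_formed a && well_formed b
  | Loop r a => [&& well_formed a, r != 0 & r \notin writes a]
  end.

Lemma size_compile p c : size (compile p c) = code_size c.
Proof.
elim: c p => //= [a IHa b IHb|r a IHa] p; rewrite ?size_cat ?IHa ?IHb //=.
by rewrite -addnS.
Qed.

Lemma run_frame c s r : r \notin writes c -> (run c s).1 r = s.1 r.
Proof.
elim: c s => [l|a IHa b IHb|q a IHa] s /=.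
- elim: l s => //= i l IH s; rewrite mem_cat negb_or => /andP[r_i /IH ->].
  case: i r_i => [q c|q x y|q x y|q x|x y|x y] //=;
  by rewrite inE => /negPf rq; rewrite rq.
- by rewrite mem_cat negb_or => /andP[ra rb]; rewrite IHb ?IHa.
rewrite !inE !negb_or => /and3P[r0 rq ra].
by elim: (s.1 q) => //= n IHn; rewrite (negPf r0) (negPf rq) IHa.
Qed.

Section Simulation.
Variable P : program.

Definition runs (m p : nat) (s : state) (q : nat) (t : state) : Prop :=
  iter m (step P) (Config p s.1 s.2) = Config q t.1 t.2.

Definition code_at (p : nat) (l : program) : Prop :=
  exists l1 l2, P = l1 ++ l ++ l2 /\ size l1 = p.

Lemma runs_trans m1 m2 p q r s t u :
  runs m1 p s q t -> runs m2 q t r u -> runs (m1 + m2) p s r u.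
Proof. by rewrite /runs addnC iterD => -> ->. Qed.

Lemma code_at_cat p l1 l2 :
  code_at p (l1 ++ l2) -> code_at p l1 /\ code_at (p + size l1) l2.
Proof.
case=> k1 [k2 [EP <-]]; split.
  by exists k1, (l2 ++ k2); rewrite EP -!catA.
by exists (k1 ++ l1), k2; rewrite EP size_cat -!catA.
Qed.

Lemma step_code_at p i l (R M : nat -> nat) :
  code_at p (i :: l) -> step P (Config p R M) = exec i (Config p R M).
Proof.
by case=> l1 [l2 [-> <-]]; rewrite /step /= onth_cat ltnn subnn.
Qed.

Lemma runs_block p l s : code_at p l -> ~~ has is_jump l ->
  runs (size l) p s (p + size l) (foldl exec_state s l).
Proof.
elim: l p s => [|i l IH] p s /= l_at; first by rewrite addn0.
rewrite negb_or => /andP[ni nl]; rewrite -addSnnS.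
have [_ /IH/(_ nl) l_runs] := code_at_cat (l_at : code_at p ([:: i] ++ l)).
rewrite addn1 in l_runs; rewrite /runs -(l_runs (exec_state s i)) iterSr.
by rewrite (step_code_at _ _ l_at); congr iter; case: (i) ni.
Qed.

Definition code_correct (c : cmd) : Prop := forall p s, well_formed c ->
  code_at p (compile p c) -> runs (cost c s) p s (p + code_size c) (run c s).

Lemma runs_test p r q l s : code_at p (IJz r q :: l) ->
  runs 1 p s (if s.1 r == 0 then q else p.+1) s.
Proof. by move=> test_at; rewrite /runs /= (step_code_at _ _ test_at). Qed.

Lemma runs_pass p r a s : code_correct a -> well_formed a ->
    code_at p (compile p (Loop r a)) -> s.1 r != 0 ->
  runs (cost a s + 5) p s p (tick r (run a s)).
Proof.
move=> a_correct wf_a loop_at sr_neq0.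
have test := runs_test s loop_at; rewrite (negPf sr_neq0) in test.
have [_] := code_at_cat (loop_at : code_at p ([:: _] ++ _)); rewrite addn1.
case/code_at_cat=> a_at /code_at_cat[dec_at jump_at].
rewrite (_ : cost a s + 5 = 1 + (cost a s + (3 + 1))); last by lia.
apply: runs_trans test (runs_trans (a_correct _ s wf_a a_at) _).
rewrite size_compile in dec_at jump_at.
apply: runs_trans (runs_block _ dec_at isT) _.
by have := runs_test (tick r (run a s)) jump_at; rewrite eqxx.
Qed.

Lemma runs_loop r a : code_correct a -> code_correct (Loop r a).
Proof.
move=> a_correct p s /= /and3P[wf_a r0 r_a] loop_at.
pose pass t := tick r (run a t); rewrite -/pass.
have counter i : (iter i pass s).1 r = s.1 r - i.
  elim: i => [|i IHi]; first by rewrite subn0.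
  by rewrite /pass /tick /= eqxx (negPf r0) /= run_frame // IHi -subnDA addn1.
have passes n : n <= s.1 r ->
    runs (\sum_(i < n) (cost a (iter i pass s) + 5)) p s p (iter n pass s).
  elim: n => [|n IHn] lt_n; first by rewrite big_ord0.
  rewrite big_ord_recr; apply: runs_trans (IHn (ltnW lt_n)) _.
  apply: runs_pass a_correct wf_a loop_at _.
  by rewrite counter subn_eq0 -ltnNge.
rewrite -addn1; apply: runs_trans (passes _ (leqnn _)) _.
by have := runs_test (iter (s.1 r) pass s) loop_at; rewrite counter subnn addnA.
Qed.

Lemma compile_correct c : code_correct c.
Proof.
elim: c => [l p s wf_l l_at|a IHa b IHb p s|r a /runs_loop //].
  exact: runs_block.
move=> /= /andP[wf_a wf_b] /code_at_cat[a_at]; rewrite size_compile => b_at.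
by rewrite addnA; apply: runs_trans (IHa _ s wf_a a_at) (IHb _ _ wf_b b_at).
Qed.

End Simulation.

Lemma compile_computes c input output t : well_formed c ->
    cost c (fun=> 0, nth 0 input) <= t ->
    (forall i, i < size output ->
       (run c (fun=> 0, nth 0 input)).2 i = nth 0 output i) ->
  computes_within (compile 0 c) input output t.
Proof.
set s := (_, _) => wf_c le_t output_ok; rewrite /computes_within /=.
have c_at : code_at (compile 0 c) 0 (compile 0 c).
  by exists [::], [::]; rewrite cats0.
have c_runs := compile_correct s wf_c c_at; rewrite add0n in c_runs.
have halt n x : iter n (step (compile 0 c)) (Config (code_size c) x.1 x.2)
    = Config (code_size c) x.1 x.2.
  elim: n => //= n ->; rewrite /step /= -(size_compile 0 c).
  by rewrite onth_default.
have -> : iter t (step (compile 0 c)) (init input)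
    = Config (code_size c) (run c s).1 (run c s).2.
  by rewrite -(subnK le_t) iterD c_runs halt.
by split; rewrite /halted /= ?size_compile.
Qed.

(** * Total correctness with time bounds *)

Definition triple (s : state) (c : cmd) (b : nat) (Q : state -> Prop) : Prop :=
  Q (run c s) /\ cost c s <= b.

Definition same_off (W : seq nat) (s t : state) : Prop :=
  forall r, r \notin W -> t.1 r = s.1 r.

Lemma same_off_trans W1 W2 s t u :
  same_off W1 s t -> same_off W2 t u -> same_off (W1 ++ W2) s u.
Proof.
by move=> st tu r; rewrite mem_cat negb_or => /andP[r1 r2]; rewrite tu ?st.
Qed.

Lemma triple_do s l b (Q : state -> Prop) :
  Q (foldl exec_state s l) -> size l <= b -> triple s (Do l) b Q.
Proof. by []. Qed.

Lemma triple_seq Q1 b1 b2 s a c b (Q : state -> Prop) : triple s a b1 Q1 ->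
    (forall t, same_off (writes a) s t -> Q1 t -> triple t c b2 Q) ->
    b1 + b2 <= b ->
  triple s (a ;; c) b Q.
Proof.
case=> q1 le_b1 c_ok le_b; have [|q le_b2] := c_ok _ _ q1.
  by move=> r; apply: run_frame.
by split=> //; apply: leq_trans (leq_add le_b1 le_b2) le_b.
Qed.

Lemma triple_weaken Q' b' s c b (Q : state -> Prop) : triple s c b' Q' ->
    (forall t, same_off (writes c) s t -> Q' t -> Q t) -> b' <= b ->
  triple s c b Q.
Proof.
case=> q' le_b' Q'Q le_b; split; last exact: leq_trans le_b.
by apply: Q'Q => // r; apply: run_frame.
Qed.

Lemma triple_loop (I : nat -> state -> Prop) b n s r a : r != 0 ->
    r \notin writes a -> s.1 r = n -> I 0 s ->
    (forall i t, i < n -> same_off (writes (Loop r a)) s t -> I i t ->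
       triple t a b (fun t' => I i.+1 (tick r t'))) ->
  triple s (Loop r a) (n * (b + 5)).+1 (I n).
Proof.
move=> r0 r_a sr I0 pass_ok; pose pass t := tick r (run a t).
have I_iter i : i <= n ->
    I i (iter i pass s) /\ same_off (writes (Loop r a)) s (iter i pass s).
  elim: i => [|i IHi] lt_i; first by split.
  have [Ii off_i] := IHi (ltnW lt_i); have [Ii' _] := pass_ok _ _ lt_i off_i Ii.
  split=> // x xW; move: (xW); rewrite !inE !negb_or => /and3P[x0 xr xa].
  by rewrite /= (negPf x0) (negPf xr) run_frame ?off_i.
split; first by rewrite /= sr; case: (I_iter n).
rewrite /= sr ltnS -[n in n * _]card_ord -sum_nat_const; apply: leq_sum => i _.
have [Ii off_i] := I_iter i (ltnW (ltn_ord i)).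
by have [_ le_b] := pass_ok _ _ (ltn_ord i) off_i Ii; rewrite leq_add2r.
Qed.

Lemma triple_when (b : bool) k (s : state) r a (Q : state -> Prop) : r != 0 ->
    r \notin writes a -> s.1 r = b :> nat ->
    (b -> triple s a k (fun t => Q (tick r t))) -> (~~ b -> Q s) ->
  triple s (Loop r a) (b * (k + 5)).+1 Q.
Proof.
case: b => r0 r_a sr a_ok skip_ok; last first.
  by split; rewrite /= sr ?big_ord0 //; apply: skip_ok.
pose I i t := if i is 0 then t = s else Q t.
apply: (triple_weaken (triple_loop (I := I) (b := k) r0 r_a sr erefl _)) => //.
by case=> // t _ _ ->; apply: a_ok.
Qed.

(** * Counted loops and multiplication *)

(* Registers 1 to 9 hold the constants 1, |V|, |E|, |C|, |V||C|, |V|^2,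
   |V|^2|C|, the address of the table and 0. *)
Local Notation rONE := 1 (only parsing).
Local Notation rN := 2 (only parsing).
Local Notation rE := 3 (only parsing).
Local Notation rC := 4 (only parsing).
Local Notation rNC := 5 (only parsing).
Local Notation rNN := 6 (only parsing).
Local Notation rNNC := 7 (only parsing).
Local Notation rBASE := 8 (only parsing).
Local Notation rZERO := 9 (only parsing).
Local Notation rFLAG := 10 (only parsing).
Local Notation rROUNDS := 11 (only parsing).
Local Notation rROUND := 12 (only parsing).
Local Notation rEDGE := 13 (only parsing).
Local Notation rI := 14 (only parsing).
Local Notation rJ := 15 (only parsing).
Local Notation rK := 16 (only parsing).
Local Notation rFST := 17 (only parsing).
Local Notation rSND := 18 (only parsing).
Local Notation rX := 19 (only parsing).
Local Notation rY := 20 (only parsing).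
Local Notation rXOFF := 21 (only parsing).
Local Notation rYOFF := 22 (only parsing).
Local Notation rUV := 23 (only parsing).
Local Notation rUX := 24 (only parsing).
Local Notation rYV := 25 (only parsing).
Local Notation rPTR := 26 (only parsing).
Local Notation rVAL := 27 (only parsing).
Local Notation rCUR := 28 (only parsing).
Local Notation rTMP := 29 (only parsing).
Local Notation rOUT := 30 (only parsing).

Definition for_cmd (r k : nat) (a : cmd) : cmd :=
  Do [:: IAdd r k rZERO] ;; Loop r a.

Lemma triple_for (I : nat -> state -> Prop) b n b' s r k a (Q : state -> Prop) :
    s.1 rZERO = 0 -> r \notin 0 :: writes a -> s.1 k = n -> 0 < n ->
    I 0 (upd s.1 r n, s.2) ->
    (forall i t, i < n -> same_off (writes (for_cmd r k a)) s t -> I i t ->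
       triple t a b (fun t' => I i.+1 (tick r t'))) ->
    (forall t, same_off (writes (for_cmd r k a)) s t -> I n t -> Q t) ->
    n * (b + 7) <= b' ->
  triple s (for_cmd r k a) b' Q.
Proof.
rewrite inE negb_or => s0 /andP[r0 r_a] sk n_gt0 I0 pass_ok IQ le_b'.
apply: (triple_weaken (Q' := I n) _ IQ le_b').
apply: (triple_seq (b1 := 1) (b2 := (n * (b + 5)).+1)
  (Q1 := fun t => t = (upd s.1 r n, s.2))) => [|t off_t Et|].
- by apply: triple_do; rewrite // /exec_state /= sk s0 addn0.
- apply: triple_loop => //; rewrite Et //=; first by rewrite /upd eqxx.
  move=> i t' lt_i off_t' It'; apply: pass_ok => //.
  by apply: same_off_trans off_t _; rewrite Et.
by rewrite !mulnDr; lia.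
Qed.

Definition mul_cmd (t x k : nat) : cmd :=
  Do [:: IConst t 0] ;; for_cmd rK k (Do [:: IAdd t t x]).

Lemma mul_spec t x k y n s :
    t \notin [:: 0; rK; rZERO; k; x] -> x \notin [:: 0; rK] ->
    s.1 rZERO = 0 -> s.1 x = y -> s.1 k = n -> 0 < n ->
  triple s (mul_cmd t x k) (9 * n) (fun s' => s'.1 t = n * y /\ s'.2 = s.2).
Proof.
rewrite !inE !negb_or => /and5P[t0 tK tZ tk tx] /andP[x0 xK] s0 sx sk n_gt0.
apply: (triple_seq (b1 := 1) (b2 := n * 8) (Q1 := fun s' =>
  [/\ s'.1 t = 0, s'.1 k = n, s'.1 x = y, s'.1 rZERO = 0 & s'.2 = s.2])).
- apply: triple_do => //; rewrite /= /upd eqxx !(eq_sym _ t).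
  by rewrite (negPf tZ) (negPf tk) (negPf tx).
- move=> s1 _ [s1t s1k s1x s10 s1M].
  apply: (triple_for (n := n) (b := 1) (I := fun i s' =>
    [/\ s'.1 t = i * y, s'.1 x = y & s'.2 = s.2])) => //.
  + by rewrite /= !inE (eq_sym _ t).
  + by rewrite /= /upd (negPf tK) (negPf xK).
  + move=> i s' _ _ [s't s'x s'M]; apply: triple_do => //=.
    rewrite /upd (negPf t0) (negPf tK) (negPf x0) (negPf xK) (eq_sym x).
    by rewrite (negPf tx) eqxx s't s'x mulSnr.
  by move=> s' _ [].
by lia.
Qed.

(** * The dynamic program *)

(* The minimum of [a] and [b] is [a - (a - b)]. *)
Definition min_block (r s : nat) : seq instr :=
  [:: ISub rTMP r s; ISub r r rTMP].

Definition lower_block (p r : nat) : seq instr :=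
  ILoad rCUR p :: min_block rCUR r ++ [:: IStore p rCUR].

Definition row_min_cmd : cmd :=
  Do [:: ILoad rVAL rUV; IAdd rPTR rUV rZERO] ;;
  for_cmd rK rC
    (Do (ILoad rCUR rPTR :: min_block rVAL rCUR ++ [:: IAdd rPTR rPTR rONE])).

Definition recolour_row_cmd : cmd :=
  row_min_cmd ;; Do [:: IAdd rVAL rVAL rONE] ;;
  for_cmd rK rC (Do (lower_block rUV rVAL ++ [:: IAdd rUV rUV rONE])).

Definition recolour_cmd : cmd :=
  Do [:: IAdd rUV rBASE rZERO] ;; for_cmd rI rNN recolour_row_cmd.

(* While the entry (u,v,d) is relaxed along the edge xy, [rUV], [rUX] and [rYV]
   point to the entries (u,v,d), (u,x,d) and (y,v,d). *)
Definition split_row_cmd : cmd :=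
  for_cmd rK rC
    (Do ([:: ILoad rVAL rUX; ILoad rCUR rYV; IAdd rVAL rVAL rCUR]
         ++ lower_block rUV rVAL
         ++ [:: IAdd rUV rUV rONE; IAdd rUX rUX rONE; IAdd rYV rYV rONE])) ;;
  Do [:: ISub rUX rUX rC].

Definition split_plane_cmd : cmd :=
  Do [:: IAdd rUX rUV rXOFF; IAdd rYV rBASE rYOFF] ;;
  for_cmd rJ rN split_row_cmd.

Definition split_cmd : cmd :=
  Do [:: IAdd rUV rBASE rZERO] ;; for_cmd rI rN split_plane_cmd.

Definition dart_cmd (p q : nat) : cmd :=
  Do [:: ILoad rX p; ILoad rY q] ;;
  mul_cmd rXOFF rX rC ;; mul_cmd rYOFF rY rNC ;; split_cmd.

Definition darts_cmd : cmd := dart_cmd rFST rSND ;; dart_cmd rSND rFST.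

Definition edge_cmd : cmd :=
  Do [:: IAdd rSND rFST rONE] ;; darts_cmd ;; Do [:: IAdd rFST rSND rONE].

Definition edges_cmd : cmd :=
  Do [:: IConst rFST 3; IAdd rFST rFST rN] ;; for_cmd rEDGE rE edge_cmd.

Definition round_cmd : cmd := recolour_cmd ;; edges_cmd.

Definition rounds_cmd : cmd :=
  Do [:: IAdd rROUNDS rN rN] ;; for_cmd rROUND rROUNDS round_cmd.

Definition fill_cmd : cmd :=
  Do [:: IAdd rPTR rBASE rZERO] ;;
  for_cmd rI rNNC (Do [:: IStore rPTR rN; IAdd rPTR rPTR rONE]).

Definition diagonal_cell_cmd : cmd :=
  Do [:: ILoad rX rFST; IAdd rPTR rUV rX; IStore rPTR rZERO;
         IAdd rFST rFST rONE; IAdd rUV rUV rNC; IAdd rUV rUV rC].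

Definition diagonal_cmd : cmd :=
  Do [:: IConst rFST 3; IAdd rUV rBASE rZERO] ;;
  for_cmd rI rN diagonal_cell_cmd.

Definition output_cell_cmd : cmd :=
  row_min_cmd ;; Do [:: IStore rOUT rVAL; IAdd rOUT rOUT rONE; IAdd rUV rUV rC].

Definition output_cmd : cmd :=
  Do [:: IConst rOUT 0; IAdd rUV rBASE rZERO] ;; for_cmd rI rNN output_cell_cmd.

Definition setup_cmd : cmd :=
  mul_cmd rNC rC rN ;; mul_cmd rNN rN rN ;; mul_cmd rNNC rNC rN ;;
  Do [:: IConst rBASE 3; IAdd rBASE rBASE rN; IAdd rBASE rBASE rE;
         IAdd rBASE rBASE rE; IAdd rBASE rBASE rNN].

Definition table_cmd : cmd :=
  setup_cmd ;; fill_cmd ;; diagonal_cmd ;; rounds_cmd ;; output_cmd.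

(* [rFLAG] is set to min(1, |E|): without edges |V| <= 1, so the output is at
   most one zero, and the running time must not depend on |C|. Storing 0 in the
   cell 0, which holds |V|, provides this output. *)
Definition linking_cmd : cmd :=
  Do [:: IConst rONE 1; IConst rZERO 0; ILoad rN rZERO; ILoad rE rONE;
         IAdd rTMP rONE rONE; ILoad rC rTMP; IStore rZERO rZERO;
         IAdd rFLAG rONE rZERO; ISub rTMP rFLAG rE; ISub rFLAG rFLAG rTMP] ;;
  Loop rFLAG table_cmd.

(** * Tables in memory *)

Definition rk (T : finType) (x : T) : nat := enum_rank x.

Lemma rk_lt (T : finType) (x : T) : rk x < #|T|.
Proof. exact: ltn_ord. Qed.

Lemma rk_inj (T : finType) : injective (@rk T).
Proof. by move=> x y /ord_inj/enum_rank_inj. Qed.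

Lemma rk_onto (T : finType) i : i < #|T| -> exists x : T, rk x = i.
Proof.
by move=> lt_i; exists (enum_val (Ordinal lt_i)); rewrite /rk enum_valK.
Qed.

Lemma muln_addn_inj q a b a' b' : b < q -> b' < q -> a * q + b = a' * q + b' ->
  a = a' /\ b = b'.
Proof.
move=> lt_b lt_b' /(congr1 (edivn ^~ q)) /=.
by rewrite !edivn_eq // => -[].
Qed.

Definition rk_pair (S T : finType) (x : S) (y : T) : nat := rk x * #|T| + rk y.

Lemma rk_pair_lt (S T : finType) (x : S) (y : T) : rk_pair x y < #|S| * #|T|.
Proof.
apply: (@leq_trans ((rk x).+1 * #|T|)); last by rewrite leq_mul2r rk_lt orbT.
by rewrite mulSnr ltn_add2l rk_lt.
Qed.

Lemma rk_pair_inj (S T : finType) (x x' : S) (y y' : T) :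
  rk_pair x y = rk_pair x' y' -> x = x' /\ y = y'.
Proof.
by case/(muln_addn_inj (rk_lt y) (rk_lt y')) => /rk_inj -> /rk_inj ->.
Qed.

Lemma rk_pair_onto (S T : finType) i : i < #|S| * #|T| ->
  exists (x : S) (y : T), rk_pair x y = i.
Proof.
move=> lt_i; have T_gt0 : 0 < #|T| by case: #|T| lt_i => //; rewrite muln0.
have [x rx] : exists x : S, rk x = i %/ #|T|.
  by apply: rk_onto; rewrite ltn_divLR.
have [y ry] : exists y : T, rk y = i %% #|T|.
  by apply: rk_onto; rewrite ltn_mod.
by exists x, y; rewrite /rk_pair rx ry -divn_eq.
Qed.

Definition lower (M : nat -> nat) (a z : nat) : nat -> nat :=
  upd M a (minn (M a) z).

Lemma lower_at M a z : lower M a z a <= z.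
Proof. by rewrite /lower /upd eqxx geq_minr. Qed.

Lemma lower_le M a z b : lower M a z b <= M b.
Proof. by rewrite /lower /upd; case: eqP => [->|_] //; apply: geq_minl. Qed.

Section Tables.
Variables (V C : finType) (B : nat).
Local Notation n := #|V|.
Local Notation c := #|C|.
Implicit Types (M : nat -> nat) (u v x y : V) (d a : C).

Definition row (i : nat) : nat := B + i * c.

Definition slot u v d : nat := row (rk_pair u v) + rk d.

Definition table M u v d : nat := M (slot u v d).

Lemma row0 : row 0 = B.
Proof. exact: addn0. Qed.

Lemma row_add i k : row i + k * c = row (i + k).
Proof. by rewrite /row mulnDl addnA. Qed.

Lemma row_next i : row i + c = row i.+1.
Proof. by rewrite -addn1 -row_add mul1n. Qed.

Lemma slotE u v d : slot u v d = B + (rk_pair u v * c + rk d).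
Proof. by rewrite /slot /row addnA. Qed.

Lemma slot_inj u v d u' v' d' : slot u v d = slot u' v' d' ->
  [/\ u = u', v = v' & d = d'].
Proof.
rewrite !slotE => /addnI/(muln_addn_inj (rk_lt d) (rk_lt d'))[].
by move=> /rk_pair_inj[-> ->] /rk_inj ->.
Qed.

Lemma slot_ge u v d : B <= slot u v d.
Proof. by rewrite slotE leq_addr. Qed.

Lemma slot_lt u v d : slot u v d < B + n * n * c.
Proof.
rewrite slotE ltn_add2l; apply: (@leq_trans ((rk_pair u v).+1 * c)).
  by rewrite mulSnr ltn_add2l rk_lt.
by rewrite leq_mul2r rk_pair_lt orbT.
Qed.

Definition is_row_min M u v (z : nat) : Prop :=
  (forall d, z <= table M u v d) /\ exists d, table M u v d = z.

Variable f : V -> V -> C -> nat.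

Definition sound M : Prop := forall u v d, f u v d <= table M u v d.

Definition agrees (M0 M : nat -> nat) : Prop := forall i, i < B -> M i = M0 i.

Lemma agrees_upd M0 M i z : agrees M0 M -> B <= i -> agrees M0 (upd M i z).
Proof.
by move=> M0M le_i j lt_j; rewrite /= ltn_eqF ?M0M // (leq_trans lt_j).
Qed.

Definition refines (M0 M : nat -> nat) : Prop :=
  [/\ agrees M0 M, forall i, M i <= M0 i & sound M].

Lemma refines_trans M0 M1 M2 : refines M0 M1 -> refines M1 M2 -> refines M0 M2.
Proof.
move=> [E1 le1 _] [E2 le2 M2_sound]; split=> // i; last first.
  exact: leq_trans (le1 i).
by move=> lt_i; rewrite E2 ?E1.
Qed.

Lemma refines_table M0 M u v d :
  refines M0 M -> table M u v d <= table M0 u v d.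
Proof. by case=> _ le _; apply: le. Qed.

Lemma lower_refines M0 M u v d z : refines M0 M -> f u v d <= z ->
  refines M0 (lower M (slot u v d) z).
Proof.
move=> [E le M_sound] z_sound; split=> [|i|u' v' d'].
- exact/agrees_upd/slot_ge.
- exact: leq_trans (lower_le _ _ _ _) (le i).
rewrite /table /lower /upd; case: eqP => [/slot_inj[-> -> ->]|_]; last first.
  exact: M_sound.
by rewrite leq_min [X in X && _]M_sound z_sound.
Qed.

Definition below_upto (p : nat) (g : V -> V -> C -> nat) M : Prop :=
  forall u v d, slot u v d < p -> table M u v d <= g u v d.

Lemma below_upto_base g M : below_upto (row 0) g M.
Proof. by move=> u v d; rewrite row0 ltnNge slot_ge. Qed.

Lemma below_upto_end g M : below_upto (row (n * n)) g M ->
  forall u v d, table M u v d <= g u v d.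
Proof. by move=> le_g u v d; apply: le_g; apply: slot_lt. Qed.

Lemma below_upto_lower p g M i z :
  below_upto p g M -> below_upto p g (lower M i z).
Proof. by move=> le_g u v d /le_g; apply: leq_trans (lower_le _ _ _ _). Qed.

Lemma below_upto_next g M u v d z :
    below_upto (slot u v d) g M -> z <= g u v d ->
  below_upto (slot u v d).+1 g (lower M (slot u v d) z).
Proof.
move=> le_g le_z u' v' d'; rewrite ltnS leq_eqVlt.
case/predU1P=> [/slot_inj[-> -> ->]|].
  exact: leq_trans (lower_at _ _ _) le_z.
exact: below_upto_lower.
Qed.

Definition split_sum M x y u v d : nat := table M u x d + table M y v d.

Definition split_along (M0 : nat -> nat) x y M : Prop :=
  forall u v d, table M u v d <= split_sum M0 x y u v d.

Lemma split_along_source M0 M1 M x y :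
  refines M0 M1 -> split_along M1 x y M -> split_along M0 x y M.
Proof.
move=> M01 split1 u v d; apply: leq_trans (split1 _ _ _) _.
by apply: leq_add; apply: refines_table.
Qed.

Lemma split_along_result M0 M1 M x y :
  refines M1 M -> split_along M0 x y M1 -> split_along M0 x y M.
Proof.
by move=> M1M split1 u v d; apply: leq_trans (refines_table _ _ _ M1M) _.
Qed.

End Tables.

(** * Correctness and cost of a round *)

Section Passes.
Variables (V C : finType) (B : nat) (es : seq (V * V)).
Local Notation n := #|V|.
Local Notation c := #|C|.
Local Notation cells := (n * n * c).
Local Notation row := (row C B).
Local Notation slot := (@slot V C B).
Local Notation table := (@table V C B).
Local Notation is_row_min := (@is_row_min V C B).
Local Notation below_upto := (@below_upto V C B).
Implicit Types (s t : state) (u v x y : V) (d a : C).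

(* Stated as products of equations, these can be used as rewrite rules. *)
Definition size_regs s : Prop :=
  ((s.1 rONE = 1) * (s.1 rN = n) * (s.1 rE = size es) * (s.1 rC = c) *
   (s.1 rZERO = 0))%type.

Definition const_regs s : Prop :=
  (size_regs s * ((s.1 rNC = (n * c)%N) * (s.1 rNN = (n * n)%N) *
              (s.1 rNNC = (n * (n * c))%N) * (s.1 rBASE = B)))%type.

Lemma size_regs_frame W s t : size_regs s -> same_off W s t ->
  all (fun r => r \notin W) [:: rONE; rN; rE; rC; rZERO] -> size_regs t.
Proof.
move=> ss st; rewrite /= => /and5P[w1 w2 w3 w4 /andP[w5 _]].
by rewrite /size_regs !st // !ss.
Qed.

Lemma const_regs_frame W s t : const_regs s -> same_off W s t ->
  all (fun r => r \notin W)
    [:: rONE; rN; rE; rC; rZERO; rNC; rNN; rNNC; rBASE] -> const_regs t.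
Proof.
move=> cs st; rewrite -[X in all _ X](cat_take_drop 5) all_cat.
case/andP=> sizes_W /= /and5P[w6 w7 w8 w9 _].
split; first exact: size_regs_frame cs.1 st sizes_W.
by rewrite !st // !cs.
Qed.

Hypothesis c_gt0 : 0 < c.

Lemma row_min_spec s u v : const_regs s -> s.1 rUV = row (rk_pair u v) ->
  triple s row_min_cmd (13 * c)
    (fun t => is_row_min s.2 u v (t.1 rVAL) /\ t.2 = s.2).
Proof.
move=> cs sp; pose p := row (rk_pair u v).
apply: (triple_seq (b1 := 2) (b2 := c * 11)
  (Q1 := fun t => [/\ t.1 rVAL = s.2 p, t.1 rPTR = p & t.2 = s.2])).
- by apply: triple_do => //; rewrite /= !cs sp addn0.
- move=> t st [tv tp tM]; have ct := const_regs_frame cs st isT.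
  apply: (triple_for (n := c) (b := 4) (I := fun i t' =>
    [/\ t'.1 rPTR = p + i, t'.2 = s.2,
        forall d, rk d < i -> t'.1 rVAL <= table s.2 u v d &
        exists d, table s.2 u v d = t'.1 rVAL])) => //; rewrite ?ct //.
  + split; rewrite ?addn0 //; have [d rd] := rk_onto c_gt0.
    by exists d; rewrite /table /slot rd addn0.
  + move=> i t' lt_i st' [t'p t'M t'_le [d0 t'v]].
    have ct' := const_regs_frame ct st' isT; have [d rd] := rk_onto lt_i.
    have t'd : t'.1 rPTR = slot u v d by rewrite t'p -rd.
    apply: triple_do => //; rewrite /tick /= ct' t'M -minnE t'd; split=> //.
    * by rewrite -t'd t'p addn1 addnS.
    * move=> d'; rewrite ltnS leq_eqVlt -{1}rd => /predU1P[/rk_inj ->|].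
        exact: geq_minr.
      by move/t'_le; apply/leq_trans/geq_minl.
    by case: leqP => _; [exists d0|exists d].
  by move=> t' _ [_ t'M t'_le t'v]; split=> //; split=> // d; apply/t'_le/rk_lt.
by lia.
Qed.

Hypothesis n_gt0 : 0 < n.

Let cells_gt0 : 0 < cells.
Proof. by rewrite !muln_gt0 n_gt0. Qed.

Variable f : V -> V -> C -> nat.
Local Notation sound := (sound B f).
Local Notation refines := (refines B f).

Section Recolouring.
Hypothesis f_recolour : forall u v a d, f u v d <= (f u v a).+1.

Definition recolour_progress M0 i k t : Prop :=
  [/\ t.1 rUV = row i + k, refines M0 t.2 &
      forall a, below_upto (t.1 rUV) (fun u v _ => (table M0 u v a).+1) t.2].

Lemma recolour_row_spec M0 u v s : const_regs s ->
    recolour_progress M0 (rk_pair u v) 0 s ->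
  triple s recolour_row_cmd (26 * c) (recolour_progress M0 (rk_pair u v).+1 0).
Proof.
move=> cs progress_s; have [sp M0s _] := progress_s; rewrite addn0 in sp.
apply: (triple_seq (b2 := 1 + c * 12) (row_min_spec cs sp)); last by lia.
move=> t st [[t_le [a ta]] tM]; have ct := const_regs_frame cs st isT.
pose z := (t.1 rVAL).+1.
have z_sound d : f u v d <= z.
  apply: leq_trans (f_recolour u v a d) _; rewrite ltnS -ta.
  by case: M0s => _ _; apply.
apply: (triple_seq (b1 := 1) (b2 := c * 12) (Q1 := fun t' =>
  t'.1 rVAL = z /\ t'.2 = s.2)) => //.
  by apply: triple_do => //; rewrite /= ct addn1.
move=> t1 st1 [t1v t1M]; have ct1 := const_regs_frame ct st1 isT.
apply: (triple_for (n := c) (b := 5) (I := fun k t' =>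
  t'.1 rVAL = z /\ recolour_progress M0 (rk_pair u v) k t')) => //;
  rewrite ?ct1 //.
- by rewrite /recolour_progress /= t1M (st1 rUV) // (st rUV).
- move=> k t' lt_k st' [t'v [t'p M0t' t'_upto]].
  have ct' := const_regs_frame ct1 st' isT; have [d rd] := rk_onto lt_k.
  have t'd : t'.1 rUV = slot u v d by rewrite t'p -rd.
  apply: triple_do => //; rewrite /recolour_progress /tick /= ct' t'v t'd.
  rewrite -minnE -/(lower _ _ _) addn1; split=> //; split.
  + by rewrite -t'd t'p addnS.
  + exact: lower_refines.
  move=> b; apply: below_upto_next; first by rewrite -t'd.
  by rewrite ltnS; apply: leq_trans (refines_table _ _ _ M0s).
by move=> t' _ [_ [t'p M0t' t'_upto]]; split=> //; rewrite addn0 t'p row_next.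
Qed.

Lemma recolour_spec s : const_regs s -> sound s.2 ->
  triple s recolour_cmd (34 * cells) (fun t => refines s.2 t.2 /\
    forall u v a d, table t.2 u v d <= (table s.2 u v a).+1).
Proof.
move=> cs s_sound.
apply: (triple_seq (b1 := 1) (b2 := n * n * (26 * c + 7)) (Q1 := fun t =>
  t.1 rUV = row 0 /\ t.2 = s.2)).
- by apply: triple_do => //; rewrite /= !cs row0 addn0.
- move=> t st [tp tM]; have ct := const_regs_frame cs st isT.
  apply: (triple_for (n := n * n) (b := 26 * c) (I := fun i t' =>
    recolour_progress s.2 i 0 t')) => //; rewrite ?ct ?muln_gt0 ?n_gt0 //.
  + split; rewrite /= ?tp ?tM ?addn0 //.
    by move=> a; apply: below_upto_base.
  + move=> i t' lt_i st' progress_t'; have [u [v uv]] := rk_pair_onto lt_i.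
    rewrite -uv in progress_t' *.
    exact: recolour_row_spec (const_regs_frame ct st' isT) progress_t'.
  move=> t' _ [t'p M0t' t'_upto]; split=> // u v a.
  by apply: (below_upto_end (g := fun u v _ => _)); rewrite -[row _]addn0 -t'p.
by rewrite !mulnDr; nia.
Qed.

End Recolouring.

Section Splitting.
Variables (M0 : nat -> nat) (x y : V).
Hypothesis f_split : forall u v d, f u v d <= f u x d + f y v d.

Local Notation bound := (@split_sum V C B M0 x y).

Definition split_progress i j k t : Prop :=
  [/\ t.1 rUV = row (i * n + j) + k, t.1 rUX = row (i * n + rk x) + k,
      t.1 rYV = row (rk y * n + j) + k, refines M0 t.2 &
      below_upto (t.1 rUV) bound t.2].

Lemma split_row_spec u v s : const_regs s -> split_progress (rk u) (rk v) 0 s ->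
  triple s split_row_cmd (18 * c) (split_progress (rk u) (rk v).+1 0).
Proof.
move=> cs split_s.
apply: (triple_seq (b1 := 17 * c) (b2 := 1)
  (Q1 := split_progress (rk u) (rk v) c)).
- apply: (triple_for (n := c) (b := 10)
    (I := split_progress (rk u) (rk v))) => //; rewrite ?cs //.
  + move=> k t lt_k st split_t; have ct := const_regs_frame cs st isT.
    have [d rd] := rk_onto lt_k; rewrite -rd in split_t *.
    have [tuv tux tyv M0t t_upto] : [/\ t.1 rUV = slot u v d,
      t.1 rUX = slot u x d, t.1 rYV = slot y v d, refines M0 t.2 &
      below_upto (t.1 rUV) bound t.2] := split_t.
    have [_ _ t_sound] := M0t; rewrite tuv in t_upto.
    apply: triple_do => //; rewrite /split_progress /tick /= ct tuv tux tyv.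
    rewrite -minnE !addn1 !addnS; split=> //.
    * apply: lower_refines => //; apply: leq_trans (f_split u v d) _.
      by apply: leq_add; apply: t_sound.
    apply: below_upto_next t_upto _.
    by apply: leq_add; apply: refines_table M0t.
  by rewrite mulnC.
- move=> t st [tuv tux tyv M0t t_upto]; have ct := const_regs_frame cs st isT.
  apply: triple_do => //; rewrite /split_progress /= ct.
  by rewrite tux addnK !addn0 !addnS -!row_next; split.
by lia.
Qed.

Lemma split_plane_spec u s : const_regs s ->
    s.1 rXOFF = rk x * c -> s.1 rYOFF = rk y * (n * c) ->
    s.1 rUV = row (rk u * n) -> refines M0 s.2 ->
    below_upto (s.1 rUV) bound s.2 ->
  triple s split_plane_cmd (27 * (n * c)) (fun t =>
    [/\ t.1 rUV = row ((rk u).+1 * n), refines M0 t.2 &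
        below_upto (t.1 rUV) bound t.2]).
Proof.
move=> cs sx sy sp M0s s_upto.
apply: (triple_seq (b1 := 2) (b2 := n * (18 * c + 7))
  (Q1 := split_progress (rk u) 0 0)).
- apply: triple_do => //; rewrite /split_progress /= !cs sx sy !addn0 sp.
  by rewrite mulnA -addnA -mulnDl; split=> //; rewrite -sp.
- move=> t st split_t; have ct := const_regs_frame cs st isT.
  apply: (triple_for (n := n) (b := 18 * c)
    (I := fun j => split_progress (rk u) j 0)) => //; rewrite ?ct //.
  + move=> j t' lt_j st' split_t'; have [v rv] := rk_onto lt_j.
    rewrite -rv in split_t' *.
    exact: split_row_spec (const_regs_frame ct st' isT) split_t'.
  move=> t' _ [t'uv _ _ M0t' t'_upto]; split=> //.
  by rewrite t'uv addn0 mulSnr.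
have : 0 < n * c by rewrite muln_gt0 n_gt0.
by rewrite !mulnDr; nia.
Qed.

Lemma split_spec s : const_regs s ->
    s.1 rXOFF = rk x * c -> s.1 rYOFF = rk y * (n * c) ->
    s.2 = M0 -> sound M0 ->
  triple s split_cmd (35 * cells) (fun t =>
    refines M0 t.2 /\ split_along C B M0 x y t.2).
Proof.
move=> cs sx sy sM M0_sound.
apply: (triple_seq (b1 := 1) (b2 := n * (27 * (n * c) + 7)) (Q1 := fun t =>
  t.1 rUV = row 0 /\ t.2 = s.2)).
- by apply: triple_do => //; rewrite /= !cs row0 addn0.
- move=> t st [tp tM]; have ct := const_regs_frame cs st isT.
  apply: (triple_for (n := n) (b := 27 * (n * c)) (I := fun i t' =>
    [/\ t'.1 rUV = row (i * n), refines M0 t'.2 &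
        below_upto (t'.1 rUV) bound t'.2])) => //; rewrite ?ct //.
  + by rewrite /= tp tM sM; split=> //; apply: below_upto_base.
  + move=> i t' lt_i st' [t'p M0t' t'_upto]; have [u ru] := rk_onto lt_i.
    have ct' := const_regs_frame ct st' isT; rewrite -ru in t'p *.
    by apply: split_plane_spec => //; rewrite st' // st.
  move=> t' _ [t'p M0t' t'_upto]; split=> //.
  by rewrite t'p in t'_upto; apply: below_upto_end.
by rewrite !mulnDr; nia.
Qed.

End Splitting.

Section Edges.
Variables (e : rel V) (inp : nat -> nat).
Hypothesis f_edge : forall u x y v d, e x y -> f u v d <= f u x d + f y v d.
Hypothesis e_es : forall x y, e x y = ((x, y) \in es) || ((y, x) \in es).
Hypothesis inp_edge : forall p i, i < size es ->
  inp (3 + n + i.*2) = rk (nth p es i).1 /\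
  inp (3 + n + i.*2).+1 = rk (nth p es i).2.
Hypothesis input_below : 3 + n + (size es).*2 <= B.

Local Notation split_along := (split_along C B).

Lemma dart_spec p q x y s : const_regs s -> q != rX -> e x y -> sound s.2 ->
    s.2 (s.1 p) = rk x -> s.2 (s.1 q) = rk y ->
  triple s (dart_cmd p q) (55 * cells) (fun t =>
    refines s.2 t.2 /\ split_along s.2 x y t.2).
Proof.
move=> cs qX exy s_sound sx sy.
apply: (triple_seq (b1 := 2) (b2 := 9 * c + (9 * (n * c) + 35 * cells))
  (Q1 := fun t => [/\ t.1 rX = rk x, t.1 rY = rk y & t.2 = s.2])).
- by apply: triple_do => //; rewrite /= (negPf qX).
- move=> t st [tx ty tM]; have ct := const_regs_frame cs st isT.
  have mul_x : triple t (mul_cmd rXOFF rX rC) (9 * c)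
    (fun t1 => t1.1 rXOFF = c * rk x /\ t1.2 = t.2).
    by apply: mul_spec; rewrite ?ct.
  apply: (triple_seq mul_x) => // t1 st1 [t1x t1M].
  have ct1 := const_regs_frame ct st1 isT.
  have mul_y : triple t1 (mul_cmd rYOFF rY rNC) (9 * (n * c))
    (fun t2 => t2.1 rYOFF = n * c * rk y /\ t2.2 = t1.2).
    by apply: mul_spec; rewrite ?ct1 ?(st1 rY) ?muln_gt0 ?n_gt0.
  apply: (triple_seq mul_y) => // t2 st2 [t2y t2M].
  apply: split_spec (const_regs_frame ct1 st2 isT) _ _ _ s_sound.
  + by move=> u v d; apply: f_edge.
  + by rewrite st2 // t1x mulnC.
  + by rewrite t2y mulnC.
  by rewrite t2M t1M tM.
have : c <= cells by rewrite leq_pmull // muln_gt0 n_gt0.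
have : n * c <= cells by rewrite leq_mul2r leq_pmulr // orbT.
by lia.
Qed.

Lemma darts_spec x y s : const_regs s -> e x y -> e y x -> sound s.2 ->
    s.1 rFST < B -> s.2 (s.1 rFST) = rk x ->
    s.1 rSND < B -> s.2 (s.1 rSND) = rk y ->
  triple s darts_cmd (110 * cells) (fun t =>
    [/\ refines s.2 t.2, split_along s.2 x y t.2 & split_along s.2 y x t.2]).
Proof.
move=> cs exy eyx s_sound fst_lt s_fst snd_lt s_snd.
have xy_spec := dart_spec (q := rSND) cs isT exy s_sound s_fst s_snd.
apply: (triple_seq (b2 := 55 * cells) xy_spec).
- move=> t st [s_t split_xy]; have ct := const_regs_frame cs st isT.
  have [t_agrees _ t_sound] := s_t.
  have t_snd : t.2 (t.1 rSND) = rk y by rewrite st // t_agrees.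
  have t_fst : t.2 (t.1 rFST) = rk x by rewrite st // t_agrees.
  have yx_spec := dart_spec (q := rFST) ct isT eyx t_sound t_snd t_fst.
  apply: (triple_weaken yx_spec) => //.
  move=> t' _ [t_t' split_yx]; split; first exact: refines_trans t_t'.
    exact: split_along_result t_t' split_xy.
  exact: split_along_source s_t split_yx.
by move: cells => q; lia.
Qed.

Definition edges_progress M0 i t : Prop :=
  [/\ t.1 rFST = 3 + n + i.*2, refines M0 t.2 &
      forall p, p \in take i es ->
        split_along M0 p.1 p.2 t.2 /\ split_along M0 p.2 p.1 t.2].

Lemma edge_spec M0 i s : const_regs s -> agrees B inp M0 -> i < size es ->
    edges_progress M0 i s ->
  triple s edge_cmd (112 * cells) (edges_progress M0 i.+1).
Proof.
move=> cs M0_inp lt_i [s_fst M0s s_split].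
have p0 : V * V by case: (es) lt_i.
have [inp_x inp_y] := inp_edge p0 lt_i.
case Ep: (nth p0 es i) inp_x inp_y => [x y] /= inp_x inp_y.
have xy_in : (x, y) \in es by rewrite -Ep mem_nth.
have exy : e x y by rewrite e_es xy_in.
have eyx : e y x by rewrite e_es xy_in orbT.
have [s_agrees _ s_sound] := M0s; pose a := 3 + n + i.*2.
have lt_a : a.+1 < B.
  apply: leq_trans input_below.
  by rewrite -!addnS -doubleS leq_add2l leq_double.
apply: (triple_seq (b1 := 1) (b2 := 110 * cells + 1)
  (Q1 := fun t => [/\ t.1 rFST = a, t.1 rSND = a.+1 & t.2 = s.2])).
- by apply: triple_do => //; rewrite /= cs s_fst addn1.
- move=> t st [t_fst t_snd tM]; have ct := const_regs_frame cs st isT.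
  apply: (triple_seq (@darts_spec x y t ct exy eyx _ _ _ _ _)) => //.
  + by rewrite tM.
  + by rewrite t_fst ltnW.
  + by rewrite tM t_fst s_agrees ?M0_inp // ltnW.
  + by rewrite t_snd.
  + by rewrite tM t_snd s_agrees ?M0_inp.
  move=> t1 st1 [s_t1 split_xy split_yx].
  have ct1 := const_regs_frame ct st1 isT; rewrite tM in s_t1 split_xy split_yx.
  apply: triple_do => //; rewrite /edges_progress /= ct1 st1 // t_snd.
  split; first by rewrite addn1 doubleS !addnS.
    exact: refines_trans s_t1.
  move=> p; rewrite (take_nth p0) // mem_rcons inE Ep.
  case/predU1P=> [->|/s_split[pxy pyx]].
    split; first exact: split_along_source M0s split_xy.
    exact: split_along_source M0s split_yx.
  split; first exact: split_along_result s_t1 pxy.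
  exact: split_along_result s_t1 pyx.
by move: cells cells_gt0 => q; lia.
Qed.

Lemma edges_spec s :
    const_regs s -> agrees B inp s.2 -> sound s.2 -> 0 < size es ->
  triple s edges_cmd (121 * (size es * cells)) (fun t =>
    refines s.2 t.2 /\ forall x y, e x y -> split_along s.2 x y t.2).
Proof.
move=> cs s_inp s_sound es_gt0.
apply: (triple_seq (b1 := 2) (b2 := size es * (112 * cells + 7)) (Q1 := fun t =>
  t.1 rFST = 3 + n /\ t.2 = s.2)).
- by apply: triple_do => //; rewrite /= cs.
- move=> t st [tfst tM]; have ct := const_regs_frame cs st isT.
  apply: (triple_for (n := size es) (b := 112 * cells)
    (I := edges_progress s.2)) => //; rewrite ?ct //.
  + by rewrite /edges_progress /= tfst tM addn0 take0.
  + move=> i t' lt_i st' progress_t'.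
    exact: edge_spec (const_regs_frame ct st' isT) s_inp lt_i progress_t'.
  move=> t' _ [_ st'M t'_split]; split=> // x y.
  by rewrite take_size in t'_split; rewrite e_es => /orP[] /t'_split[].
by rewrite mulnDr; nia.
Qed.

Hypothesis f_recolour : forall u v a d, f u v d <= (f u v a).+1.

Lemma round_spec s :
    const_regs s -> agrees B inp s.2 -> sound s.2 -> 0 < size es ->
  triple s round_cmd (155 * (size es * cells)) (fun t =>
    refines s.2 t.2 /\ relaxes e (table s.2) (table t.2)).
Proof.
move=> cs s_inp s_sound es_gt0.
apply: (triple_seq (recolour_spec f_recolour cs s_sound)
  (b2 := 121 * (size es * cells))).
- move=> t st [st_ref t_recolour]; have [s_agrees _ t_sound] := st_ref.
  have t_inp : agrees B inp t.2 by move=> i lt_i; rewrite s_agrees ?s_inp.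
  have ct := const_regs_frame cs st isT.
  apply: (triple_weaken (edges_spec ct t_inp t_sound es_gt0)) => //.
  move=> t' _ [tt' t'_split]; have st' := refines_trans st_ref tt'.
  split=> //; split.
  + by move=> u v d; apply: refines_table st'.
  + move=> u v a d; apply: leq_trans (refines_table _ _ _ tt') _.
    exact: t_recolour.
  move=> u x y v d exy.
  exact: (split_along_source st_ref (t'_split x y exy)).
by move: cells => q; nia.
Qed.

End Edges.

End Passes.

(** * Correctness and cost of the program *)

(* The table lies above the input, which fills 3 + |V| + 2|E| cells, and above
   the output, which overwrites the input. *)
Definition table_base (V : finType) (es : seq (V * V)) : nat :=
  3 + #|V| + size es + size es + #|V| * #|V|.

Lemma setup_spec (V C : finType) (es : seq (V * V)) s :
    0 < #|V| -> size_regs C es s ->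
  triple s setup_cmd (27 * #|V| + 5) (fun t =>
    const_regs C (table_base es) es t /\ t.2 = s.2).
Proof.
move=> n_gt0 ss; set n := #|V| in n_gt0 *; set c := #|C|.
apply: (triple_seq (b1 := 9 * n) (b2 := 9 * n + (9 * n + 5))
  (Q1 := fun t => t.1 rNC = n * c /\ t.2 = s.2)); last by lia.
  by apply: mul_spec; rewrite ?ss.
move=> t1 st1 [t1nc t1M]; have ss1 := size_regs_frame ss st1 isT.
apply: (triple_seq (b1 := 9 * n) (b2 := 9 * n + 5)
  (Q1 := fun t => t.1 rNN = n * n /\ t.2 = t1.2)) => //.
  by apply: mul_spec; rewrite ?ss1.
move=> t2 st2 [t2nn t2M]; have ss2 := size_regs_frame ss1 st2 isT.
have t2nc : t2.1 rNC = n * c by rewrite st2.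
apply: (triple_seq (b1 := 9 * n) (b2 := 5)
  (Q1 := fun t => t.1 rNNC = n * (n * c) /\ t.2 = t2.2)) => //.
  by apply: mul_spec; rewrite ?ss2.
move=> t3 st3 [t3nnc t3M]; have ss3 := size_regs_frame ss2 st3 isT.
apply: triple_do => //; split; last by rewrite /= t3M t2M t1M.
by rewrite /const_regs /size_regs /= !ss3 t3nnc !st3 // t2nn t2nc.
Qed.

Section Instance.
Variables (V C : finType) (es : seq (V * V)).
Variables (e : rel V) (w : colouring V C) (inp : nat -> nat).
Hypothesis e_sym : symmetric e.
Hypothesis e_conn : connected_graph e.
Hypothesis es_gt0 : 0 < size es.
Hypothesis e_es : forall x y, e x y = ((x, y) \in es) || ((y, x) \in es).
Hypothesis inp_colour : forall v, inp (3 + rk v) = rk (w v).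
Hypothesis inp_edge : forall p i, i < size es ->
  inp (3 + #|V| + i.*2) = rk (nth p es i).1 /\
  inp (3 + #|V| + i.*2).+1 = rk (nth p es i).2.

Local Notation n := #|V|.
Local Notation c := #|C|.
Local Notation m := (size es).
Local Notation cells := (n * n * c).
Local Notation B := (table_base es).
Local Notation m3 := (m3 e_conn w).
Local Notation m2 := (m2 e_conn w).
Local Notation row := (row C B).
Local Notation slot := (@slot V C B).
Local Notation table := (@table V C B).
Local Notation const_regs := (@const_regs V C B es).
Local Notation sound := (sound B m3).
Implicit Types (s t : state) (u v : V) (d a : C).

Let n_gt0 : 0 < n.
Proof. by case: es es_gt0 => // -[x _] _ _; apply/card_gt0P; exists x. Qed.

Let c_gt0 : 0 < c.
Proof. by case: es es_gt0 => // -[x _] _ _; apply/card_gt0P; exists (w x). Qed.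

Let input_below : 3 + n + m.*2 <= B.
Proof. by rewrite -addnn addnA leq_addr. Qed.

Let output_below : n * n <= B.
Proof. exact: leq_addl. Qed.

Lemma fill_spec s : const_regs s ->
  triple s fill_cmd (10 * cells) (fun t =>
    agrees B s.2 t.2 /\ forall u v d, table t.2 u v d = n).
Proof.
move=> cs; apply: (triple_seq (b1 := 1) (b2 := n * (n * c) * (2 + 7))
  (Q1 := fun t => t.1 rPTR = B /\ t.2 = s.2)).
- by apply: triple_do => //; rewrite /= !cs addn0.
- move=> t st [tp tM]; have ct := const_regs_frame cs st isT.
  apply: (triple_for (n := n * (n * c)) (b := 2) (I := fun i t' =>
    [/\ t'.1 rPTR = B + i, agrees B s.2 t'.2 &
        forall j, j < i -> t'.2 (B + j) = n])) => //;
    rewrite ?ct ?muln_gt0 ?n_gt0 //.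
  + by rewrite /= tp tM addn0.
  + move=> i t' _ st' [t'p t'_low t'_full].
    have ct' := const_regs_frame ct st' isT.
    apply: triple_do => //; rewrite /tick /= !ct' t'p addn1 addnS; split=> //.
      by apply: agrees_upd; rewrite ?leq_addr.
    move=> j; rewrite eqn_add2l ltnS leq_eqVlt.
    by case: eqP => //= _; apply: t'_full.
  move=> t' _ [_ t'_low t'_full]; split=> // u v d.
  by rewrite /table slotE t'_full // mulnA -(ltn_add2l B) -slotE slot_lt.
rewrite mulnA; have : 0 < cells by rewrite !muln_gt0 n_gt0.
by move: cells => q; lia.
Qed.

Definition diagonal_progress i t : Prop :=
  [/\ t.1 rFST = 3 + i, t.1 rUV = row (i * n + i), agrees B inp t.2, sound t.2 &
      forall u, rk u < i -> table t.2 u u (w u) = 0].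

Lemma diagonal_cell_spec u s : const_regs s -> diagonal_progress (rk u) s ->
  triple s diagonal_cell_cmd 6 (diagonal_progress (rk u).+1).
Proof.
move=> cs [sfst suv s_inp s_sound s_diag].
have below : 3 + rk u < B.
  by apply: leq_trans input_below; rewrite -addnA ltn_add2l ltn_addr ?rk_lt.
have addr : s.1 rUV + s.2 (s.1 rFST) = slot u u (w u).
  by rewrite sfst s_inp // suv inp_colour.
apply: triple_do => //; rewrite /diagonal_progress /= !cs addr sfst suv; split.
- by rewrite addn1 addnS.
- by rewrite row_add row_next addnAC addnS -mulSnr.
- exact/agrees_upd/slot_ge.
- move=> u' v d; rewrite /table /=; case: eqP => [/slot_inj[-> -> ->]|_].
    by rewrite m3_refl.
  exact: s_sound.
move=> u'; rewrite ltnS leq_eqVlt /table /= => /predU1P[/rk_inj ->|lt_u'].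
  by rewrite eqxx.
by case: eqP => // _; apply: s_diag.
Qed.

Lemma diagonal_spec s : const_regs s -> agrees B inp s.2 ->
    (forall u v d, table s.2 u v d = n) ->
  triple s diagonal_cmd (15 * n) (fun t =>
    [/\ agrees B inp t.2, sound t.2 & forall u, table t.2 u u (w u) = 0]).
Proof.
move=> cs s_inp s_full; apply: (triple_seq (b1 := 2) (b2 := n * (6 + 7))
  (Q1 := fun t => [/\ t.1 rFST = 3, t.1 rUV = row 0 & t.2 = s.2])).
- by apply: triple_do => //; rewrite /= !cs row0 addn0.
- move=> t st [tfst tuv tM]; have ct := const_regs_frame cs st isT.
  apply: (triple_for (n := n) (b := 6) (I := diagonal_progress)) => //;
    rewrite ?ct //.
  + rewrite /diagonal_progress /= tfst tuv tM; split=> // u v d.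
    by rewrite s_full m3_le_card.
  + move=> i t' lt_i st' diag_t'; have [u ru] := rk_onto lt_i.
    rewrite -ru in diag_t' *.
    exact: diagonal_cell_spec (const_regs_frame ct st' isT) diag_t'.
  move=> t' _ [_ _ t'_inp t'_sound t'_diag]; split=> // u.
  exact/t'_diag/rk_lt.
by move: n_gt0; lia.
Qed.

Lemma rounds_spec s : const_regs s -> agrees B inp s.2 -> sound s.2 ->
    (forall u, table s.2 u u (w u) = 0) ->
  triple s rounds_cmd (325 * (n * (m * cells))) (fun t =>
    forall u v d, table t.2 u v d = m3 u v d).
Proof.
move=> cs s_inp s_sound s_diag.
apply: (triple_seq (b1 := 1) (b2 := (n + n) * (155 * (m * cells) + 7))
  (Q1 := fun t => t.1 rROUNDS = n + n /\ t.2 = s.2)).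
- by apply: triple_do => //; rewrite /= !cs.
- move=> t st [tr tM]; have ct := const_regs_frame cs st isT.
  apply: (triple_for (n := n + n) (b := 155 * (m * cells)) (I := fun r t' =>
    [/\ agrees B inp t'.2, sound t'.2 & reaches e w r (table t'.2)])) => //;
    rewrite ?ct ?addn_gt0 ?n_gt0 //.
  + by rewrite /= tM; split=> //; apply: reaches0.
  + move=> r t' _ st' [t'_inp t'_sound t'_reaches].
    have ct' := const_regs_frame ct st' isT.
    have m3_recol u v a d := m3_recolour e_sym e_conn w u v a d.
    have m3_split u x y v d := m3_edge e_sym e_conn w u v d (x := x) (y := y).
    apply: (triple_weaken (round_spec c_gt0 n_gt0 m3_split e_es inp_edge
      input_below m3_recol ct' t'_inp t'_sound es_gt0)) => //.
    move=> t1 _ [[t1_agrees _ t1_sound] t1_relaxes]; split=> //.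
      by move=> a lt_a; rewrite /= t1_agrees ?t'_inp.
    exact: reachesS t1_relaxes t'_reaches.
  move=> t' _ [_ t'_sound t'_reaches] u v d; apply/anti_leq/andP; split.
    exact: reaches_m3 t'_reaches.
  exact: t'_sound.
have : 0 < m * cells by rewrite !muln_gt0 es_gt0 n_gt0.
by move: n n_gt0 (m * cells) => k k_gt0 q; nia.
Qed.

Definition output_progress i t : Prop :=
  [/\ t.1 rOUT = i, t.1 rUV = row i, forall u v d, table t.2 u v d = m3 u v d &
      forall u v, rk_pair u v < i -> t.2 (rk_pair u v) = m2 u v].

Lemma output_cell_spec u v s :
    const_regs s -> output_progress (rk_pair u v) s ->
  triple s output_cell_cmd (13 * c + 3) (output_progress (rk_pair u v).+1).
Proof.
move=> cs [sout suv s_m3 s_m2].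
apply: (triple_seq (b2 := 3) (row_min_spec c_gt0 cs suv)) => //.
move=> t st [[t_le [d t_d]] tM]; have ct := const_regs_frame cs st isT.
have tval : t.1 rVAL = m2 u v.
  symmetry; apply: m2_eq_min; first by move=> a; rewrite -s_m3.
  by exists d; rewrite -s_m3.
have tout : t.1 rOUT = rk_pair u v by rewrite st.
have tuv : t.1 rUV = row (rk_pair u v) by rewrite st.
apply: triple_do => //; rewrite /output_progress /= ct tM tval tout tuv; split.
- by rewrite addn1.
- by rewrite ct row_next.
- move=> u' v' a; rewrite /table /= gtn_eqF ?[LHS]s_m3 //.
  apply: leq_trans (rk_pair_lt u v) (leq_trans output_below _).
  exact: slot_ge.
move=> u' v'; rewrite ltnS leq_eqVlt => /predU1P[/rk_pair_inj[-> ->]|lt_uv].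
  by rewrite eqxx.
by rewrite ltn_eqF ?s_m2.
Qed.

Lemma output_spec s :
    const_regs s -> (forall u v d, table s.2 u v d = m3 u v d) ->
  triple s output_cmd (25 * cells) (fun t =>
    forall u v, t.2 (rk_pair u v) = m2 u v).
Proof.
move=> cs s_m3; apply: (triple_seq (b1 := 2) (b2 := n * n * (13 * c + 3 + 7))
  (Q1 := fun t => [/\ t.1 rOUT = 0, t.1 rUV = row 0 & t.2 = s.2])).
- by apply: triple_do => //; rewrite /= !cs row0 addn0.
- move=> t st [tout tuv tM]; have ct := const_regs_frame cs st isT.
  apply: (triple_for (n := n * n) (b := 13 * c + 3)
    (I := output_progress)) => //; rewrite ?ct ?muln_gt0 ?n_gt0 //.
  + by rewrite /output_progress /= tout tuv tM.
  + move=> i t' lt_i st' out_t'; have [u [v uv]] := rk_pair_onto lt_i.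
    rewrite -uv in out_t' *.
    exact: output_cell_spec (const_regs_frame ct st' isT) out_t'.
  by move=> t' _ [_ _ _ t'_m2] u v; apply/t'_m2/rk_pair_lt.
by rewrite !mulnDr; move: n_gt0 c_gt0; nia.
Qed.

Lemma table_spec s : size_regs C es s -> s.2 = inp ->
  triple s table_cmd (408 * (n * (m * cells))) (fun t =>
    forall u v, t.2 (rk_pair u v) = m2 u v).
Proof.
move=> ss sM; have cells_gt0 : 0 < cells by rewrite !muln_gt0 n_gt0.
apply: (triple_seq (setup_spec n_gt0 ss)
  (b2 := 10 * cells + (15 * n + (325 * (n * (m * cells)) + 25 * cells)))).
- move=> t1 _ [c1 t1M].
  apply: (triple_seq (fill_spec c1)) => // t2 st2 [t2_low t2_full].
  have c2 := const_regs_frame c1 st2 isT; rewrite t1M sM in t2_low.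
  apply: (triple_seq (diagonal_spec c2 t2_low t2_full)) => //.
  move=> t3 st3 [t3_inp t3_sound t3_diag].
  have c3 := const_regs_frame c2 st3 isT.
  apply: (triple_seq (rounds_spec c3 t3_inp t3_sound t3_diag)) => //.
  move=> t4 st4 t4_m3.
  exact: output_spec (const_regs_frame c3 st4 isT) t4_m3.
have le_n : n <= n * (m * cells) by rewrite leq_pmulr // muln_gt0 es_gt0.
have le_cells : cells <= n * (m * cells).
  by rewrite mulnA leq_pmull // muln_gt0 n_gt0.
by move: (n * (m * cells)) cells n le_n le_cells n_gt0 => x y z; lia.
Qed.

End Instance.

(** * Input and output encodings *)

Lemma rk_pair_edgeless (V : finType) (e : rel V) (u v : V) :
    connected_graph e -> (forall x y, e x y = false) ->
  u = v /\ rk_pair u v = 0.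
Proof.
move=> e_conn edgeless; have all_eq x y : x = y :> V.
  by case/connectP: (e_conn x y) => -[//|z p] /=; rewrite edgeless.
split; first exact: all_eq.
have V_le1 : #|V| <= 1 by apply/card_le1_eqP => x y _ _; apply: all_eq.
apply/eqP; rewrite -leqn0 -ltnS (leq_trans (rk_pair_lt u v)) //.
exact: (leq_mul V_le1 V_le1).
Qed.

Lemma set2_eq (T : finType) (a b x y : T) : x != y ->
  [set a; b] = [set x; y] -> (a = x /\ b = y) \/ (a = y /\ b = x).
Proof.
move=> xy E; have := set21 a b; have := set22 a b; rewrite {1 2}E !inE.
have := set21 x y; have := set22 x y; rewrite -{1 2}E !inE.
do 4![case/orP=> /eqP ?]; subst; rewrite ?eqxx in xy *; by [left|right].
Qed.

Lemma edge_listingP (V : finType) (e : rel V) es : simple_graph e ->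
    edge_listing e es ->
  size es = #|edges e| /\
  forall x y, e x y = ((x, y) \in es) || ((y, x) \in es).
Proof.
case=> e_sym e_irr listing; have mem_listing := perm_mem listing.
have neq x y : e x y -> x != y by apply: contraTneq => ->; rewrite e_irr.
have listed x y : (x, y) \in es -> e x y.
  move/(map_f (fun p => [set p.1; p.2])); rewrite mem_listing mem_enum.
  case/imset2P=> a b _; rewrite inE => /andP[_ eab] /(set2_eq (neq _ _ eab)) /=.
  by case=> -[-> ->] //; rewrite e_sym.
split; first by have := perm_size listing; rewrite size_map -cardE.
move=> x y; apply/idP/orP => [exy|[/listed //|/listed]]; last by rewrite e_sym.
have : [set x; y] \in enum (edges e).
  by rewrite mem_enum; apply/imset2P; exists x y => //; rewrite inE.
rewrite -mem_listing => /mapP[[a b] ab_in /esym/(set2_eq (neq _ _ exy))] /=.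
by case=> -[<- <-]; [left|right].
Qed.

Lemma nth_encode_table (V : finType) (g : V -> V -> nat) u v :
  nth 0 (encode_table g) (rk_pair u v) = g u v.
Proof.
rewrite /encode_table /rk_pair cardE (nth_allpairs _ u v) -?cardE ?rk_lt //.
by rewrite !nth_enum_rank.
Qed.

Section Encoding.
Variables (V C : finType) (es : seq (V * V)) (w : colouring V C).

Lemma nth_encode_colour v : nth 0 (encode_instance es w) (3 + rk v) = rk (w v).
Proof.
rewrite /encode_instance nth_cat ltnNge leq_addr addKn nth_cat size_map -cardE.
by rewrite rk_lt (nth_map v) ?nth_enum_rank // -cardE rk_lt.
Qed.

Lemma nth_encode_edge p i : i < size es ->
  nth 0 (encode_instance es w) (3 + #|V| + i.*2) = rk (nth p es i).1 /\
  nth 0 (encode_instance es w) (3 + #|V| + i.*2).+1 = rk (nth p es i).2.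
Proof.
have tail j : nth 0 (encode_instance es w) (3 + #|V| + j)
    = nth 0 (flatten [seq [:: rk q.1; rk q.2] | q <- es]) j.
  rewrite /encode_instance -addnA nth_cat ltnNge leq_addr addKn.
  by rewrite nth_cat size_map -cardE ltnNge leq_addr addKn.
move=> lt_i; rewrite -addnS !tail.
exact: (nth_flatten_pairs (fun q => rk q.1) (fun q => rk q.2)).
Qed.

End Encoding.

Lemma linking_spec (V C : finType) (e : rel V) (w : colouring V C)
    (es : seq (V * V)) (e_conn : connected_graph e) (s : state) : symmetric e ->
    (forall x y, e x y = ((x, y) \in es) || ((y, x) \in es)) ->
    s.2 = nth 0 (encode_instance es w) ->
  triple s linking_cmd (408 * (#|V| ^ 3 * size es * #|C| + 1)) (fun t =>
    forall u v, t.2 (rk_pair u v) = m2 e_conn w u v).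
Proof.
move=> e_sym e_es sM; pose k := 408 * (#|V| * (size es * (#|V| * #|V| * #|C|))).
apply: (triple_seq (b1 := 10) (b2 := ((0 < size es) * (k + 5)).+1)
  (Q1 := fun t =>
    [/\ size_regs C es t, t.1 rFLAG = (0 < size es) & t.2 = upd s.2 0 0])).
- apply: triple_do => //; rewrite /size_regs /= sM /encode_instance /=.
  by split=> //; case: (size es) => [|[]].
- move=> t _ [st tflag tM]; apply: triple_when => // [es_gt0|].
    apply: table_spec => //.
    + by move=> v; rewrite tM sM; apply: nth_encode_colour.
    by move=> p i lt_i; rewrite tM sM; apply: nth_encode_edge.
  rewrite -leqNgt leqn0 => /eqP/size0nil es0 u v.
  have edgeless x y : e x y = false by rewrite e_es es0.
  have [<- ->] := rk_pair_edgeless u v e_conn edgeless.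
  by rewrite tM m2_refl.
rewrite /k !expnS expn0; case: (size es) => [|m] /=; first by lia.
by rewrite mul1n; lia.
Qed.

Theorem theorem4p8 :
  exists (P : program) (K : nat),
    forall (V C : finType) (e : rel V) (w : colouring V C) (es : seq (V * V)),
      simple_graph e ->
      forall e_conn : connected_graph e,
      edge_listing e es ->
      computes_within P (encode_instance es w) (encode_table (m2 e_conn w))
        (K * (#|V| ^ 3 * #|edges e| * #|C| ^ 2 + 1)).
Proof.
exists (compile 0 linking_cmd), 408 => V C e w es simple_e e_conn listing.
have [e_sym _] := simple_e; have [<- e_es] := edge_listingP simple_e listing.
have [output_ok le_cost] := linking_spec (w := w)
  (s := (fun=> 0, nth 0 (encode_instance es w))) e_conn e_sym e_es erefl.
apply: compile_computes => // [|i].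
  have c_le_sq : #|C| <= #|C| ^ 2 by case: #|C| => // k; apply: leq_pmulr.
  apply: leq_trans le_cost _.
  by rewrite leq_mul2l leq_add2r leq_mul2l c_le_sq !orbT.
rewrite size_allpairs -cardE => /rk_pair_onto[u [v <-]].
by rewrite output_ok nth_encode_table.
Qed.
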